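(* Let $T:\Omega\to\Omega$ be a mixing Gibbs–Markov map preserving the probability measure $\mu$, with partition $\{\Omega_j\}$ and constant $\theta\in(0,1)$. Let $v:\Omega\to\mathbb{R}$ be measurable with $\int_\Omega v^2\,d\mu=\infty$, fix $\alpha\in(0,1)\cup(1,2]$, and suppose that as $x\to\infty$, $\mu(v>x)=p\ell(x)x^{-\alpha}(1+o(1))$ and $\mu(v<-x)=q\ell(x)x^{-\alpha}(1+o(1))$ with $\ell$ slowly varying, $p,q>0$, $p+q=1$. Assume $v$ is locally Lipschitz, i.e. $|v|_\theta=\sup_j D_jv<\infty$, and that there is $C>0$ with $D_jv\le C\inf_{y\in\Omega_j}|v(y)|$ for all $j$. Assume $\int_\Omega v\,d\mu=0$ if $\alpha\in(1,2]$. Write $v_n=\sum_{j=0}^{n-1}v\circ T^j$ and assume $(v_n-b_n)/a_n$ converges in distribution to an $\alpha$-stable law, with $a_n,b_n$ as in the context. Let $\delta>0$ be arbitrarily small and set $D(x)=(\log x)\ell(x)x^{-\alpha}$ if $\alpha\in(0,1)$ and $D(x)=x^{-(\alpha-\delta)}$ if $\alpha\in(1,2]$. Let $N=N(n)$ with $N\to\infty$ and $N/a_n\to\infty$. Then as $n\to\infty$: for $\alpha\in(0,1)\cup(1,2)$, \[|\mu(v_n>N)-n\mu(v>N)|=O(D(N))+o(n\ell(N)N^{-\alpha}),\] and similarly for $\mu(v_n<-N)$ versus $n\mu(v<-N)$; for $\alpha=2$, \[|\mu(v_n>N)-n\mu(v>N)|=O(D(N))+O(n\log N\,N^{-2})+O(n\hat\ell(N)N^{-2}),\]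 and similarly for $\mu(v_n\le -N)$.
   Context: Gibbs–Markov map: $(\Omega,\mu)$ a probability space with an at most countable measurable partition $\{\Omega_j\}$, $T$ ergodic and measure-preserving; $s(y,y')$ is the least $n\ge0$ such that $T^ny,T^ny'$ lie in distinct partition elements (assumed $s(y,y')=\infty$ iff $y=y'$), $d_\theta(y,y')=\theta^{s(y,y')}$; $g=d\mu/d(\mu\circ T)$. $T$ is Gibbs–Markov if each $T(\Omega_j)$ is a union of partition elements and $T|_{\Omega_j}$ is a measurable bijection onto $T(\Omega_j)$; $\inf_j\mu(T\Omega_j)>0$; and there are $C>0$, $\theta\in(0,1)$ with $|\log g(y)-\log g(y')|\le Cd_\theta(y,y')$ for $y,y'\in\Omega_j$. $D_jf=\sup_{y\ne y'\in\Omega_j}|f(y)-f(y')|/d_\theta(y,y')$. $\hat\ell(x)=1+\int_1^{1+x}\ell(u)u^{-1}du$. $a_n^\alpha=n\ell(a_n)(1+o(1))$ if $\alpha\in(0,2)$, $a_n^2=n\hat\ell(a_n)(1+o(1))$ if $\alpha=2$; $b_n=0$ if $\alpha\in(0,1)$ and $b_n=n\int v\,d\mu$ if $\alpha\in(1,2]$. *)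

(* Defs.v *)
From HB Require Import structures.
From mathcomp Require Import all_boot all_order all_algebra.
From mathcomp Require Import all_classical all_reals all_analysis.
Set Implicit Arguments. Unset Strict Implicit. Unset Printing Implicit Defensive.
Import Order.TTheory GRing.Theory Num.Theory.
Import numFieldNormedType.Exports.
Local Open Scope classical_set_scope.
Local Open Scope ring_scope.

Section GibbsMarkov.
Context {R : realType} {d : measure_display} {Omega : measurableType d}
  {J : countType}.
Variables (P : J -> set Omega) (T : Omega -> Omega).

Definition distinct_at (n : nat) (y y' : Omega) : bool :=
  `[< ~ exists j, P j (iter n T y) /\ P j (iter n T y') >].

(* d_theta(y,y') = theta^{s(y,y')}, s = least n with distinct_at n;
   theta^oo = 0 when no such n exists *)
Definition dtheta (theta : R) (y y' : Omega) : R :=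
  match pselect (exists n, distinct_at n y y') with
  | left h => theta ^+ (ex_minn h)
  | right _ => 0
  end.

Definition is_partition : Prop :=
  (forall j, measurable (P j)) /\ (forall j, P j !=set0) /\
  (forall i j, i != j -> P i `&` P j = set0) /\
  (\bigcup_j P j = setT).

Definition Dj_le (theta : R) (f : Omega -> R) (j : J) (K : R) : Prop :=
  forall y y', P j y -> P j y' -> y <> y' -> `|f y - f y'| <= K * dtheta theta y y'.

End GibbsMarkov.

Section Dynamics.
Context {R : realType} {d : measure_display} {Omega : measurableType d}.

Definition measure_preserving (mu : probability Omega R) (T : Omega -> Omega) :=
  measurable_fun setT T /\
  forall A, measurable A -> mu (T @^-1` A) = mu A.

Definition ergodic (mu : probability Omega R) (T : Omega -> Omega) :=
  forall A, measurable A -> T @^-1` A = A -> mu A = 0%E \/ mu A = 1%E.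

Definition mixing (mu : probability Omega R) (T : Omega -> Omega) :=
  forall A B, measurable A -> measurable B ->
    fine (mu (A `&` (iter n T) @^-1` B)) @[n --> \oo]
      --> fine (mu A) * fine (mu B).

Definition GibbsMarkov (mu : probability Omega R) (T : Omega -> Omega)
  (J : countType) (P : J -> set Omega) (theta : R) : Prop :=
  [/\ measure_preserving mu T, ergodic mu T, is_partition P &
   [/\
      (forall y y', (forall n, ~~ distinct_at P T n y y') -> y = y'),
      (forall j, exists S : set J, T @` P j = \bigcup_(i in S) P i),
      (forall j, [/\ set_inj (P j) T, measurable_fun (P j) T &
         forall A, measurable A -> A `<=` P j -> measurable (T @` A)]),
      (exists c : R, 0 < c /\ forall j, (c%:E <= mu (T @` P j))%E) &
      (0 < theta < 1)] /\
      (* g = d mu / d (mu o T), with |log g y - log g y'| <= C d_theta *)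
      exists (g : Omega -> R) (nu : {measure set Omega -> \bar R}) (C : R),
        [/\ 0 < C /\ (forall y, 0 < g y), measurable_fun setT g,
         (* nu is mu o T: nu A = mu (T A) for measurable A inside a partition element *)
         (forall j A, measurable A -> A `<=` P j -> nu A = mu (T @` A)),
         (forall A, measurable A -> mu A = (\int[nu]_(x in A) (g x)%:E)%E) &
         forall j, Dj_le P T theta (fun y => ln (g y)) j C]].

End Dynamics.

Section Asymptotics.
Context {R : realType}.

Definition slowly_varying (ell : R -> R) : Prop :=
  measurable_fun setT ell /\
  (\forall x \near +oo, 0 < ell x) /\
  forall lam : R, 0 < lam -> ell (lam * x) / ell x @[x --> +oo] --> (1 : R).

Definition ellhat (ell : R -> R) (x : R) : R :=
  1 + Rintegral (@lebesgue_measure R) `[1, 1 + x]%classic (fun u => ell u / u).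

(* explicit alpha-stable characteristic function, alpha <> 1:
   phi(t) = exp(-s^a|t|^a (1 - i b sgn(t) tan(pi a/2)) + i g t),
   written via its real and imaginary parts *)
Definition stable_law (alpha : R) (G : probability R R) : Prop :=
  exists sigma beta gamma : R, [/\ 0 < sigma, -1 <= beta <= 1 &
    forall t : R,
      let m := sigma `^ alpha * `|t| `^ alpha in
      let ph := m * beta * Num.sg t * tan (pi * alpha / 2) + gamma * t in
      Rintegral G setT (fun x => cos (t * x)) = expR (- m) * cos ph /\
      Rintegral G setT (fun x => sin (t * x)) = expR (- m) * sin ph].

Definition conv_in_distribution {d} {Omega : measurableType d}
  (mu : probability Omega R) (X : nat -> Omega -> R) (G : probability R R) :=
  forall x : R, G [set x] = 0%E ->
    fine (mu [set y | X n y <= x]) @[n --> \oo] --> fine (G [set z | z <= x]).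

End Asymptotics.

Definition birkhoff {R : realType} {Omega : Type} (T : Omega -> Omega)
  (v : Omega -> R) (n : nat) (x : Omega) : R :=
  \sum_(0 <= j < n) v (iter j T x).

(* Main.v *)
(* Bounded distortion and big images give quasi-independence: for U a union of
   k-cylinders and B measurable, mu (U /\ T^-k B) <= C mu U mu B.  Since v is
   locally Lipschitz, S_k varies by a bounded amount on k-cylinders, so the
   process may be restarted at first passage times as if its increments were
   independent.  This yields a maximal inequality and then a
   Hoffmann-Jorgensen inequality
     max_(m <= n) P(|S_m| > 5x)
       <= n P(|v| > x) + C (max_(m <= n) P(|S_m| > x))^2.
   Convergence in distribution provides tightness of S_n / a_n, from which this
   inequality is iterated, starting at x of order a_n; the outcome is
   P(|S_m| > x) <= A n Phi(x) for m <= n and x >= M a_n, where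
   Phi(x) = P(|v| > x) if alpha < 2 and Phi(x) = \hat ell(x) / x^2 if alpha = 2.
   For alpha = 2 this is already the claim.  For alpha < 2 one more restart
   shows that, up to an error O((n Phi(N))^2) = o(n Phi(N)), the event S_n > N
   is caused by a single jump v o T^k of size about N. *)

Require Import Defs.
From HB Require Import structures.
From mathcomp Require Import all_boot all_order all_algebra.
From mathcomp Require Import all_classical all_reals all_analysis.
From mathcomp Require Import measurable_realfun ring lra.
Set Implicit Arguments.
Unset Strict Implicit.
Unset Printing Implicit Defensive.
Import Order.TTheory GRing.Theory Num.Theory.
Import numFieldNormedType.Exports.
Local Open Scope classical_set_scope.
Local Open Scope ring_scope.

(** * Real-valued probabilities and countable decompositions *)

Section ProbabilityLemmas.
Context {R : realType} {d : measure_display} {Omega : measurableType d}.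
Variable mu : probability Omega R.

(** Quasi-independence costs a factor [C], yet the main term [n P(v > N)] must come out with
    constant exactly 1. This works because [C] only ever multiplies probabilities of two rare events
    occurring together; the linear term comes from invariance of [mu], with a union bound from above
    and disjoint events from below. Two obstacles shape the rest. A sum exceeding a level is not a
    union of cylinders, so events are enlarged to whole cylinders, which shifts levels by a constant
    [K], negligible against [N]. And tightness is given at time [n] and scale [a_n] only, with no
    monotonicity of [a_n], whereas the iteration needs every [m <= n] at the scale [a_n]. The
    relation [n Phi(a_n) -> 1] removes the second obstacle and also dictates [Phi]: the iteration
    leaves a remainder of constant size near the scale [a_n], which only a [Phi] with [n Phi(a_n)]
    of order 1 can absorb. For [alpha = 2] the norming therefore forces [\hat ell(x) / x^2], and the
    growth of [\hat ell] has to be controlled by hand. *)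

Definition Pr (A : set Omega) : R := fine (mu A).

Lemma PrE A : measurable A -> mu A = (Pr A)%:E.
Proof. by move=> mA; rewrite /Pr fineK// fin_num_measure. Qed.

Lemma Pr_ge0 A : 0 <= Pr A.
Proof. exact/fine_ge0/measure_ge0. Qed.

Lemma Pr_le1 A : measurable A -> Pr A <= 1.
Proof. by move=> mA; rewrite -lee_fin -PrE//; exact: probability_le1. Qed.

Lemma Pr_set0 : Pr set0 = 0.
Proof. by rewrite /Pr measure0. Qed.

Lemma le_Pr A B : measurable A -> measurable B -> A `<=` B -> Pr A <= Pr B.
Proof.
by move=> mA mB AB; rewrite -lee_fin -!PrE//; apply: le_measure; rewrite ?inE.
Qed.

Lemma Pr_setU_le A B : measurable A -> measurable B ->
  Pr (A `|` B) <= Pr A + Pr B.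
Proof.
move=> mA mB; rewrite -lee_fin EFinD -!PrE//; last exact: measurableU.
exact: measureU2.
Qed.

Lemma Pr_bigcup_le (n : nat) (A : set Omega) (F : nat -> set Omega) :
  measurable A -> (forall k, measurable (F k)) ->
  (forall y, A y -> exists2 k, (k < n)%N & F k y) ->
  Pr A <= \sum_(k < n) Pr (F k).
Proof.
move=> mA mF AF; rewrite -lee_fin -sumEFin -PrE//.
under eq_bigr do rewrite -PrE//.
apply: content_subadditive => // y /AF[k kn Fy].
by rewrite -bigcup_mkord; exists k.
Qed.

Lemma Pr_bigcup (n : nat) (F : nat -> set Omega) :
  (forall k, measurable (F k)) -> trivIset setT F ->
  \sum_(k < n) Pr (F k) = Pr (\big[setU/set0]_(k < n) F k).
Proof.
move=> mF tF; apply: EFin_inj; rewrite -PrE; last exact: bigsetU_measurable.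
rewrite measure_bigsetU//.
by rewrite -[LHS]sumEFin; apply: eq_bigr => i _; rewrite -PrE.
Qed.

Lemma Pr_le_countable_partition (I : countType) (Q : I -> set Omega)
    (A B : set Omega) (c : R) :
  0 <= c -> measurable A -> measurable B -> (forall i, measurable (Q i)) ->
  (forall i j, i != j -> Q i `&` Q j = set0) ->
  (forall y, exists i, Q i y) ->
  (forall i, Pr (A `&` Q i) <= c * Pr (B `&` Q i)) ->
  Pr A <= c * Pr B.
Proof.
move=> c0 mA mB mQ tQ cQ AB.
(* [pickle_inv] turns the countable family into a sequence, with [set0] at codes that name no
   index. *)
pose F n : set Omega := if pickle_inv n is Some i then Q i else set0.
have mF n : measurable (F n) by rewrite /F; case: pickle_inv.
have tF : trivIset setT F.
  apply/trivIsetP => m n _ _ mn; rewrite /F.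
  case Em: (pickle_inv m) => [i|]; last by rewrite set0I.
  case En: (pickle_inv n) => [j|]; last by rewrite setI0.
  apply: tQ; apply: contra_neq mn => ij; subst j.
  by move: (@pickle_invK I m) (@pickle_invK I n); rewrite Em En /= => <- <-.
have cF : \bigcup_n F n = setT.
  apply/seteqP; split => // y _; have [i Qi] := cQ y.
  by exists (pickle i) => //; rewrite /F pickleK_inv.
rewrite -lee_fin EFinM -!PrE//.
rewrite -[X in (mu X <= _)%E](setIT A) -[X in (_ <= _ * mu X)%E](setIT B).
rewrite -cF !setI_bigcupr !measure_bigcup//; last 4 first.
- by move=> n _; exact: measurableI.
- exact: trivIset_setIl.
- by move=> n _; exact: measurableI.
- exact: trivIset_setIl.
rewrite -nneseriesZl//.
apply: lee_nneseries => [n _ _|n _]; first exact: measure_ge0.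
rewrite [leLHS](PrE (measurableI _ _ mA (mF n))).
rewrite [X in (_ * X)%E](PrE (measurableI _ _ mB (mF n))).
rewrite -EFinM lee_fin /F; case: pickle_inv => [i|]; first exact: AB.
by rewrite !setI0 Pr_set0 mulr0.
Qed.

End ProbabilityLemmas.

(** * Cylinders and their unions *)

Section Cylinders.
Context {d : measure_display} {Omega : measurableType d} {J : countType}.
Variables (T : Omega -> Omega) (P : J -> set Omega).

Fixpoint cylinder (w : seq J) : set Omega :=
  if w is j :: w' then P j `&` T @^-1` cylinder w' else setT.

Definition same_cylinder (k : nat) (y z : Omega) :=
  forall i, (i < k)%N -> ~~ distinct_at P T i y z.

(** For a partition these are the unions of [k]-cylinders, that is, the events decided by the first
    [k] letters of the itinerary. *)
Definition saturated (k : nat) (U : set Omega) :=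
  forall y z, same_cylinder k y z -> U y -> U z.

(** The union of the [k]-cylinders that meet [E]: a hull to which quasi-independence applies
    whatever [E] is. *)
Definition sat (k : nat) (E : set Omega) : set Omega :=
  [set y | exists2 z, E z & same_cylinder k y z].

End Cylinders.

(** * Bounded distortion, big images and quasi-independence *)

Section QuasiIndependence.
Context {R : realType} {d : measure_display} {Omega : measurableType d}.
Context {J : countType} {mu : probability Omega R} {T : Omega -> Omega}.
Context {P : J -> set Omega} {theta : R}.
Hypothesis GM : GibbsMarkov mu T P theta.

Local Notation Pr := (Pr mu).
Local Notation cylinder := (cylinder T P).
Local Notation same_cylinder := (same_cylinder T P).
Local Notation saturated := (saturated T P).

Let mT : measurable_fun setT T. Proof. by have [[]] := GM. Qed.

Let theta01 : 0 < theta < 1.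
Proof. by have [_ _ _ [[]]] := GM. Qed.

Lemma measurable_iter k : measurable_fun setT (iter k T).
Proof.
elim: k => [|k IH] /=; first exact: measurable_id.
exact: (measurableT_comp mT IH).
Qed.

Lemma measurable_iter_preimage k A : measurable A ->
  measurable (iter k T @^-1` A).
Proof. by move=> mA; rewrite -[X in measurable X]setTI; exact: measurable_iter. Qed.

Lemma Pr_iter_preimage k A : measurable A -> Pr (iter k T @^-1` A) = Pr A.
Proof.
move=> mA; elim: k => [//|k IH]; rewrite -IH /Pr; have [[_ mp] _ _ _] := GM.
rewrite -[in RHS](mp _ (measurable_iter_preimage k mA)).
by congr (fine (mu _)); apply/funext => y; rewrite /preimage/= -iterSr.
Qed.

Lemma measurable_cylinder w : measurable (cylinder w).
Proof.
have [_ _ [mP _] _] := GM.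
elim: w => [|j w IH] /=; first exact: measurableT.
apply: measurableI => //.
by rewrite -[X in measurable X]setTI; exact: mT.
Qed.

Lemma distinct_atP i y z : reflect
  (exists j, P j (iter i T y) /\ P j (iter i T z)) (~~ distinct_at P T i y z).
Proof.
rewrite /distinct_at; apply: (iffP idP) => [/asboolPn/contrapT//|H].
by apply/asboolPn => /(_ H).
Qed.

Lemma same_cylinderS k y z : same_cylinder k.+1 y z ->
  (exists j, P j y /\ P j z) /\ same_cylinder k (T y) (T z).
Proof.
move=> H; split; first by have /distinct_atP := H 0%N isT.
move=> i ik; apply/distinct_atP; rewrite -!iterSr.
exact/distinct_atP/H.
Qed.

Lemma same_cylinder_sym k y z : same_cylinder k y z -> same_cylinder k z y.
Proof.
move=> H i ik; have /distinct_atP[j [h1 h2]] := H _ ik.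
by apply/distinct_atP; exists j.
Qed.

Lemma same_cylinder_le k m y z : (m <= k)%N ->
  same_cylinder k y z -> same_cylinder m y z.
Proof. by move=> mk H i im; apply: H; exact: leq_trans mk. Qed.

Lemma cylinder_same w y z : cylinder w y -> cylinder w z ->
  same_cylinder (size w) y z.
Proof.
elim: w y z => [//|j w IH] y z /= [yj yw] [zj zw] [_|i iw].
  by apply/distinct_atP; exists j.
have /distinct_atP[j' H] := IH _ _ yw zw i iw.
by apply/distinct_atP; exists j'; rewrite !iterSr.
Qed.

Lemma cylinder_cover k y : exists w : k.-tuple J, cylinder w y.
Proof.
have [_ _ [_ [_ [_ cov]]] _] := GM.
elim: k y => [|k IH] y; first by exists [tuple].
have [w wy] := IH (T y).
have : (\bigcup_j P j) y by rewrite cov.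
by move=> [j _ yj]; exists [tuple of j :: w].
Qed.

Lemma cylinder_disjoint w w' y : size w = size w' ->
  cylinder w y -> cylinder w' y -> w = w'.
Proof.
have [_ _ [_ [_ [dis _]]] _] := GM.
elim: w w' y => [[]//|j w IH] [//|j' w'] y /= [sw] [yj yw] [yj' yw'].
rewrite (IH _ _ sw yw yw'); congr cons; apply/eqP; apply: contraT => /dis.
by move/seteqP => [/(_ y (conj yj yj'))].
Qed.

Lemma dtheta_ge0 y z : 0 <= dtheta P T theta y z.
Proof.
rewrite /dtheta; case: pselect => // h; apply: exprn_ge0.
by case/andP: theta01 => /ltW.
Qed.

Lemma dtheta_same k y z : same_cylinder k y z ->
  dtheta P T theta y z <= theta ^+ k.
Proof.
case/andP: theta01 => t0 t1 H.
rewrite /dtheta; case: pselect => [h|_]; last exact/exprn_ge0/ltW.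
case: ex_minnP => m dm _; apply: ler_wiXn2l; [exact: ltW..|].
by rewrite leqNgt; apply/negP => /H; rewrite dm.
Qed.

Lemma Dj_le_same (f : Omega -> R) (K : R) k y z :
  0 <= K -> (forall j, Dj_le P T theta f j K) ->
  same_cylinder k.+1 y z -> `|f y - f z| <= K * theta ^+ k.+1.
Proof.
case/andP: theta01 => t0 t1 K0 fK yz.
have [->|nyz] := pselect (y = z).
  by rewrite subrr normr0 mulr_ge0// exprn_ge0// ltW.
have [[j [yj zj]] _] := same_cylinderS yz.
apply: le_trans (fK j _ _ yj zj nyz) _.
exact/ler_wpM2l/dtheta_same.
Qed.

Lemma image_iterS k (B : set Omega) :
  iter k.+1 T @` B = iter k T @` (T @` B).
Proof.
rewrite [RHS]image_comp; congr (_ @` _); apply/funext => y.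
by rewrite [RHS]/= -iterSr.
Qed.

Lemma measurable_image w A : measurable A -> A `<=` cylinder w ->
  measurable (iter (size w) T @` A).
Proof.
have [_ _ _ [[_ _ HT _ _] _]] := GM.
elim: w A => [|j w IH] A mA Aw.
  by rewrite (_ : _ @` _ = A)//; exact: image_id.
rewrite image_iterS; apply: IH => [|_ [y /Aw[_ yw] <-]//].
by have [_ _] := HT j; apply => // y /Aw[].
Qed.

(** If the cylinder is nonempty, the image of [P j] meets the next partition element and, being a
    union of partition elements, contains it. For empty [w] this fails, since the image of [P j]
    need not be everything. *)
Lemma Markov_image j w : cylinder (j :: w) !=set0 -> w != [::] ->
  T @` cylinder (j :: w) = cylinder w.
Proof.
have [_ _ [_ [_ [dis _]]] [[_ union _ _ _] _]] := GM.
case: w => // i w [y [yj yw]] _; apply/seteqP; split=> [_ [z [_ zw] <-]//|z zw].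
have [S TS] := union j.
have : (T @` P j) (T y) by exists y.
rewrite TS => -[i' Si' Pi'].
have ii' : i' = i.
  apply/eqP; apply: contraT => /dis /seteqP[/(_ (T y))] h _.
  by case: h; split => //; case: yw.
subst i'.
have : (T @` P j) z by rewrite TS; exists i => //; case: zw.
by move=> [x xj xz]; exists x => //; split => //; rewrite /preimage/= xz.
Qed.

(** [Markov_image] reduces the image of a cylinder to the image under [T] of its last partition
    element, where the uniform lower bound applies. *)
Lemma big_image : exists2 c : R, 0 < c & forall w, w != [::] ->
  cylinder w !=set0 -> c <= Pr (iter (size w) T @` cylinder w).
Proof.
have [_ _ _ [[_ _ HT [c [c0 cT]] _] _]] := GM.
exists c => //; elim => [//|j w IH] _ jw0.
have [w0|w0] := eqVneq w [::].
  subst w; rewrite -lee_fin -PrE.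
    apply: le_trans (cT j) _; rewrite le_eqVlt; apply/orP; left; apply/eqP.
    by congr (mu _); apply/seteqP; split => [_ [y yj <-]|_ [y [yj _] <-]]; exists y.
  by apply: measurable_image => //; exact: measurable_cylinder.
rewrite image_iterS Markov_image//.
by apply: IH => //; have [y [_ yw]] := jw0; exists (T y).
Qed.

(** Letters are peeled off one by one: on a cylinder of length [k], [g] varies by at most a factor
    [exp (C theta^k)], and these factors have a convergent product. The comparison of [Pr A / Pr A']
    with the ratio of the images is cross-multiplied, so that null sets need no exception. *)
Lemma cylinder_distortion : exists2 C : R, 0 <= C &
  forall w A A', measurable A -> measurable A' ->
  A `<=` cylinder w -> A' `<=` cylinder w ->
  Pr A * Pr (iter (size w) T @` A') <=
  expR (C * \sum_(i < size w) theta ^+ i.+1) *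
    (Pr A' * Pr (iter (size w) T @` A)).
Proof.
have [_ _ [mP _] [[_ _ HT _ _] [g [nu [C [[C0 g0] mg nuT muE gD]]]]]] := GM.
case/andP: theta01 => t0 t1.
(* The constant doubles because each letter uses the bound on [g] twice, from above for [A] and from
   below for [A']. *)
exists (2 * C); first by rewrite mulr_ge0// ltW.
elim => [|j w IH] A A' mA mA' Aw Aw'.
  have id0 B : iter (size (Nil J)) T @` B = B by exact: image_id.
  by rewrite !id0 big_ord0 mulr0 expR0 mul1r mulrC.
have [->|/set0P[y0 Ay0]] := eqVneq A set0.
  by rewrite Pr_set0 mul0r !mulr_ge0 ?expR_ge0 ?Pr_ge0.
set k := size (j :: w).
have imS B : iter k T @` B = iter (size w) T @` (T @` B).
  exact: image_iterS.
have mTB B : measurable B -> B `<=` cylinder (j :: w) -> measurable (T @` B).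
  by move=> mB Bw; have [_ _] := HT j; apply => // y /Bw[].
have TBw B : B `<=` cylinder (j :: w) -> T @` B `<=` cylinder w.
  by move=> Bw _ [y /Bw[_ yw] <-].
pose M := expR (C * theta ^+ k).
have M0 : 0 < M by exact: expR_gt0.
have gM y z : cylinder (j :: w) y -> cylinder (j :: w) z -> g y <= M * g z.
  move=> yw zw.
  have := Dj_le_same (ltW C0) gD (cylinder_same yw zw).
  move=> /(le_trans (ler_norm _)); rewrite -/k lerBlDr => H.
  by rewrite -[leLHS]lnK ?posrE// -[X in _ * X]lnK ?posrE// /M -expRD ler_expR.
have ub B : measurable B -> B `<=` cylinder (j :: w) ->
    Pr B <= M * g y0 * Pr (T @` B).
  move=> mB Bw; rewrite -lee_fin EFinM -!PrE//; last exact: mTB.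
  rewrite (muE B)// -(nuT j)//; last by move=> y /Bw[].
  rewrite -integral_cst//; apply: ge0_le_integral => //.
  - by move=> y _; rewrite lee_fin ltW.
  - exact/measurable_EFinP/measurable_funTS.
  - by move=> y By; rewrite lee_fin; apply: gM; [exact: Bw|exact: Aw].
have lb B : measurable B -> B `<=` cylinder (j :: w) ->
    g y0 * Pr (T @` B) <= M * Pr B.
  move=> mB Bw; rewrite -ler_pdivrMl// mulrA [M^-1 * _]mulrC.
  rewrite -lee_fin -(PrE _ mB) EFinM -PrE; last exact: mTB.
  rewrite (muE B)// -(nuT j)//; last by move=> y /Bw[].
  rewrite -integral_cst//; apply: ge0_le_integral => //.
  - by move=> y _; rewrite lee_fin divr_ge0// ltW.
  - exact/measurable_EFinP/measurable_funTS.
  - move=> y By; rewrite lee_fin ler_pdivrMr// mulrC.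
    by apply: gM; [exact: Aw|exact: Bw].
have := IH _ _ (mTB _ mA Aw) (mTB _ mA' Aw') (TBw _ Aw) (TBw _ Aw').
rewrite -!imS big_ord_recr/= mulrDr expRD -/k.
set E := expR (2 * C * _); set a := Pr (iter k T @` A); set a' := Pr _.
move=> IH'.
apply: le_trans (ler_wpM2r (Pr_ge0 _ _) (ub _ mA Aw)) _.
rewrite -[leLHS]mulrA.
apply: (@le_trans _ _ (M * g y0 * (E * (Pr (T @` A') * a)))).
  by rewrite ler_wpM2l// mulr_ge0// ltW.
have -> : expR (2 * C * theta ^+ (size w).+1) = M * M.
  by rewrite -expRD; congr expR; rewrite /k/=; ring.
rewrite [leLHS](_ : _ = M * E * a * (g y0 * Pr (T @` A'))); last by ring.
rewrite [leRHS](_ : _ = M * E * a * (M * Pr A')); last by ring.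
apply: ler_wpM2l; last exact: lb.
by rewrite !mulr_ge0 ?Pr_ge0 ?expR_ge0// ltW.
Qed.

Lemma saturated_cylinder k U (w : k.-tuple J) : saturated k U ->
  cylinder w `<=` U \/ U `&` cylinder w = set0.
Proof.
move=> sU; have [->|/set0P[y [Uy wy]]] := eqVneq (U `&` cylinder w) set0.
  by right.
left => z wz; apply: sU Uy; rewrite -(size_tuple w).
exact: cylinder_same.
Qed.

Lemma measurable_saturated k U : saturated k U -> measurable U.
Proof.
move=> sU.
rewrite (_ : U = \bigcup_(w : k.-tuple J) (U `&` cylinder w)).
  apply: countable_bigcupT_measurable => // w.
  have [wU|->//] := saturated_cylinder w sU.
  by rewrite setIidr//; exact: measurable_cylinder.
rewrite -setI_bigcupr setIidl// => y _.
by have [w wy] := cylinder_cover k y; exists w.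
Qed.

(** Distortion compares the part of a cylinder that lands in [B] with the whole cylinder: its share
    is at most [E * Pr B] divided by the measure of the full image, which is at least [c]. The
    geometric series makes [E] independent of [k], and the bound is summed over the cylinders of
    [U]. *)
Lemma quasi_independence : exists2 C : R, 1 <= C &
  forall k U B, saturated k U -> measurable B ->
  Pr (U `&` iter k T @^-1` B) <= C * (Pr U * Pr B).
Proof.
have [c c0 cT] := big_image; have [D D0 DT] := cylinder_distortion.
case/andP: theta01 => t0 t1.
pose E := expR (D / (1 - theta)).
have E0 : 0 <= E by exact: expR_ge0.
(* The summand 1 serves the empty word, which [big_image] excludes, and makes the constant at least
   1. *)
exists (1 + E / c) => [|k U B sU mB].
  by rewrite lerDl divr_ge0// ltW.
have mU := measurable_saturated sU.
have mTB := measurable_iter_preimage k mB.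
have Ec0 : 0 <= E / c by rewrite divr_ge0// ltW.
rewrite mulrCA mulrC.
apply: (@Pr_le_countable_partition _ _ _ _ _ (fun w : k.-tuple J => cylinder w)).
- by rewrite mulr_ge0 ?Pr_ge0// addr_ge0.
- exact: measurableI.
- by [].
- by move=> w; exact: measurable_cylinder.
- move=> w w' ww'; apply/seteqP; split=> // y [wy wy'].
  move/eqP: ww'; apply; apply: val_inj.
  by apply: cylinder_disjoint wy wy'; rewrite !size_tuple.
- exact: cylinder_cover.
move=> w; rewrite setIAC.
have [wU|->] := saturated_cylinder w sU; last first.
  by rewrite set0I Pr_set0 mulr0.
rewrite (setIidr wU).
have mw : measurable (cylinder w) by exact: measurable_cylinder.
have [w0|w0] := eqVneq (w : seq J) [::].
  have k0 : k = 0%N by rewrite -(size_tuple w) w0.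
  rewrite w0 /= setTI k0/=.
  rewrite (_ : _ @^-1` B = B)//.
  have -> : Pr setT = 1 by rewrite /Pr probability_setT.
  by rewrite mulr1 ler_peMl ?Pr_ge0// lerDl.
have [w1|/set0P w1] := eqVneq (cylinder w) set0.
  by rewrite w1 set0I Pr_set0 mulr0.
have := DT w (cylinder w `&` iter k T @^-1` B) (cylinder w)
  (measurableI _ _ mw mTB) mw (@subIsetl _ _ _) (@subset_refl _ _).
rewrite size_tuple.
have mimg : measurable (iter k T @` (cylinder w `&` iter k T @^-1` B)).
  have := @measurable_image w (cylinder w `&` iter k T @^-1` B).
  by rewrite size_tuple; apply; [exact: measurableI|exact: subIsetl].
have imB : Pr (iter k T @` (cylinder w `&` iter k T @^-1` B)) <= Pr B.
  by apply: le_Pr => // _ [y [_ By] <-].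
have cw := cT _ w0 w1; rewrite size_tuple in cw.
set x := Pr (_ `&` _); set u := Pr (cylinder w) => H.
have sumle : expR (D * \sum_(i < k) theta ^+ i.+1) <= E.
  rewrite ler_expR ler_wpM2l//.
  apply: (@le_trans _ _ (\sum_(i < k) theta ^+ i)).
    by apply: ler_sum => i _; rewrite exprS ger_pMl ?exprn_gt0// ltW.
  have H1 := subrX1 theta k.
  rewrite -[leRHS]div1r ler_pdivlMr ?subr_gt0//.
  have : 0 <= theta ^+ k by rewrite exprn_ge0// ltW.
  by rewrite -subr_ge0; move: H1; set S := \sum_(i < k) _ => H1; lra.
have xc : x * c <= E * (u * Pr B).
  apply: le_trans (ler_wpM2l (Pr_ge0 _ _) cw) _; apply: le_trans H _.
  apply: ler_pM => //; rewrite ?expR_ge0 ?mulr_ge0 ?Pr_ge0//.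
  by rewrite ler_wpM2l ?Pr_ge0.
apply: (@le_trans _ _ (E / c * (u * Pr B))).
  by rewrite mulrAC ler_pdivlMr.
rewrite [u * _]mulrC -[leRHS]mulrA ler_wpM2r ?mulr_ge0 ?Pr_ge0//.
by rewrite lerDr.
Qed.

End QuasiIndependence.

(** * Birkhoff sums and first passage events *)

Section BirkhoffSums.
Context {R : realType} {Omega : Type}.
Variables (T : Omega -> Omega) (v : Omega -> R).

Local Notation S := (birkhoff T v).

Lemma birkhoff0 y : S 0%N y = 0.
Proof. by rewrite /birkhoff big_geq. Qed.

Lemma birkhoffSr k y : S k.+1 y = S k y + v (iter k T y).
Proof. by rewrite /birkhoff big_nat_recr. Qed.

Lemma birkhoff1 y : S 1%N y = v y.
Proof. by rewrite birkhoffSr birkhoff0 add0r. Qed.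

Lemma birkhoffS k y : S k.+1 y = v y + S k (T y).
Proof.
elim: k => [|k IH]; first by rewrite birkhoff1 birkhoff0 addr0.
by rewrite birkhoffSr IH birkhoffSr addrA -iterSr.
Qed.

Lemma birkhoffD k m y : S (k + m)%N y = S k y + S m (iter k T y).
Proof.
elim: m => [|m IH]; first by rewrite addn0 birkhoff0 addr0.
by rewrite addnS !birkhoffSr IH addrA -iterD addnC.
Qed.

Definition absgt (k : nat) (x : R) : set Omega := [set y | x < `|S k y|].

End BirkhoffSums.

Section FirstPassageDef.
Context {R : realType} {d : measure_display} {Omega : measurableType d}.
Context {J : countType}.
Variables (T : Omega -> Omega) (P : J -> set Omega) (v : Omega -> R).

(* The first time at which |S_k| exceeds x somewhere in the k-cylinder of y:
   taking whole cylinders makes the event "first passage at time k" saturated. *)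
Definition first_passage (x : R) (k : nat) : set Omega :=
  [set y | sat T P k (absgt T v k x) y /\
           forall i, (i < k)%N -> ~ sat T P i (absgt T v i x) y].

End FirstPassageDef.

Lemma measurable_gt {R : realType} {d : measure_display}
    {Omega : measurableType d} (f : Omega -> R) (x : R) :
  measurable_fun setT f -> measurable [set y | x < f y].
Proof.
move=> mf; have := mf measurableT `]x, +oo[%classic (measurable_itv _).
by rewrite setTI preimage_itvoy.
Qed.

(** * Restarting at first passage: maximal and Hoffmann-Jorgensen inequalities *)

Section FirstPassage.
Context {R : realType} {d : measure_display} {Omega : measurableType d}.
Context {J : countType} {mu : probability Omega R} {T : Omega -> Omega}.
Context {P : J -> set Omega} {theta : R}.
Hypothesis GM : GibbsMarkov mu T P theta.
Context {v : Omega -> R} {K0 C0 K : R}.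
Hypothesis mv : measurable_fun setT v.
Hypothesis K0_ge0 : 0 <= K0.
Hypothesis v_lip : forall j, Dj_le P T theta v j K0.
Hypothesis C0_ge1 : 1 <= C0.
Hypothesis QI : forall k U B, saturated T P k U -> measurable B ->
  Pr mu (U `&` iter k T @^-1` B) <= C0 * (Pr mu U * Pr mu B).
Hypothesis K_def : K = K0 / (1 - theta).

Local Notation Pr := (Pr mu).
Local Notation S := (birkhoff T v).
Local Notation absgt := (absgt T v).
Local Notation sat := (sat T P).
Local Notation first_passage := (first_passage T P v).
Local Notation same := (same_cylinder T P).

Let theta01 : 0 < theta < 1.
Proof. by have [_ _ _ [[]]] := GM. Qed.

Let K_ge0 : 0 <= K.
Proof. by rewrite K_def divr_ge0// subr_ge0; case/andP: theta01 => _ /ltW. Qed.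

Lemma measurable_iterate k : measurable_fun setT (fun y => v (iter k T y)).
Proof. exact: (measurableT_comp mv (measurable_iter GM k)). Qed.

Lemma measurable_birkhoff k : measurable_fun setT (S k).
Proof.
elim: k => [|k IH].
  rewrite (_ : S 0%N = cst 0); first exact: measurable_cst.
  by apply/funext => y; rewrite birkhoff0.
rewrite (_ : S k.+1 = S k \+ (v \o iter k T)).
  by apply: measurable_funD => //; exact: measurable_iterate.
by apply/funext => y; rewrite birkhoffSr.
Qed.

Lemma measurable_absgt k (x : R) : measurable (absgt k x).
Proof.
apply: measurable_gt; apply: measurableT_comp; last exact: measurable_birkhoff.
exact: normr_measurable.
Qed.

Lemma birkhoff_same k y z : same k y z -> `|S k y - S k z| <= K.
Proof.
case/andP: theta01 => t0 t1 yz.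
(* Strengthened for the induction: the right side is the partial geometric sum of [K0 theta^i] over
   [i < k]. *)
have : `|S k y - S k z| <= K * (1 - theta ^+ k).
  elim: k y z yz => [|k IH] y z yz.
    by rewrite !birkhoff0 subrr normr0 expr0 subrr mulr0.
  have vyz := Dj_le_same GM K0_ge0 v_lip yz.
  have [_ /IH Syz] := same_cylinderS yz.
  rewrite !birkhoffS opprD addrACA; apply: le_trans (ler_normD _ _) _.
  apply: le_trans (lerD vyz Syz) _.
  have K0E : K0 = K * (1 - theta) by rewrite K_def divfK// gt_eqF// subr_gt0.
  rewrite {1}K0E exprS.
  have : 0 <= K * (1 - theta) * (1 - theta) * theta ^+ k.
    by rewrite !mulr_ge0 ?subr_ge0 ?exprn_ge0 // ltW.
  lra.
move/le_trans; apply; rewrite ler_piMr// lerBlDr lerDl exprn_ge0// ltW//.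
Qed.

Lemma same_refl k y : same k y y.
Proof.
have [_ _ [_ [_ [_ cov]]] _] := GM.
move=> i _; apply/distinct_atP.
have : (\bigcup_j P j) (iter i T y) by rewrite cov.
by move=> [j _ h]; exists j.
Qed.

Lemma same_trans k x y z : same k x y -> same k y z -> same k x z.
Proof.
have [_ _ [_ [_ [dis _]]] _] := GM.
move=> xy yz i ik.
have /distinct_atP[j [xj yj]] := xy _ ik.
have /distinct_atP[j' [yj' zj']] := yz _ ik.
apply/distinct_atP; exists j; split=> //.
have -> // : j = j'.
apply/eqP; apply: contraT => /dis /seteqP[/(_ (iter i T y))] h _.
by case: h.
Qed.

Lemma sub_sat k E : E `<=` sat k E.
Proof. by move=> y Ey; exists y => //; exact: same_refl. Qed.

Lemma saturated_sat k m E : (m <= k)%N -> saturated T P k (sat m E).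
Proof.
move=> mk y z yz [x Ex yx]; exists x => //.
apply: same_trans yx; apply: same_cylinder_sym.
exact: same_cylinder_le mk yz.
Qed.

Lemma sat_absgt k (x : R) y : sat k (absgt k x) y -> x - K < `|S k y|.
Proof.
move=> [z xz yz]; rewrite ltrBlDr; apply: lt_le_trans xz _.
rewrite -[leLHS]/(`|S k z|) -(subrK (S k y) (S k z)) addrC.
apply: le_trans (ler_normD _ _) _; rewrite lerD2l.
by apply: birkhoff_same; exact: same_cylinder_sym.
Qed.

Lemma saturated_first_passage x k : saturated T P k (first_passage x k).
Proof.
move=> y z yz [ky iy]; split; first exact: saturated_sat yz ky.
move=> i ik zi; apply: (iy i ik).
exact: (saturated_sat (ltnW ik) (same_cylinder_sym yz)).
Qed.

Lemma measurable_first_passage x k : measurable (first_passage x k).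
Proof. exact: (measurable_saturated GM (@saturated_first_passage x k)). Qed.

Lemma first_passage_exists (x : R) n y : x < `|S n y| ->
  exists2 k, (k <= n)%N & first_passage x k y.
Proof.
move=> xn.
have ex : exists k, `[< sat k (absgt k x) y >].
  by exists n; apply/asboolP; exact: sub_sat.
case: (ex_minnP ex) => k /asboolP ky kmin; exists k.
  by apply: kmin; apply/asboolP; exact: sub_sat.
split=> // i ik /asboolP/kmin; by rewrite leqNgt ik.
Qed.

Lemma first_passage_disjoint x : trivIset setT (first_passage x).
Proof.
move=> i j _ _ [y [[si hi] [sj hj]]].
by case: (ltngtP i j) => // [/hj/(_ si)|/hi/(_ sj)].
Qed.

(* After its first passage time the process restarts, up to the factor C0. *)
Lemma first_passage_restart n (x w p : R) (E : set Omega) :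
  measurable E ->
  (forall m, (m <= n)%N -> Pr (absgt m w) <= p) ->
  (forall y, E y -> exists k,
     [/\ (k <= n)%N, first_passage x k y & absgt (n - k) w (iter k T y)]) ->
  Pr E <= C0 * p * Pr (\big[setU/set0]_(k < n.+1) first_passage x k).
Proof.
move=> mE hp EF.
have p0 : 0 <= p by apply: le_trans (hp 0%N isT); exact: Pr_ge0.
pose F k := first_passage x k `&` iter k T @^-1` absgt (n - k) w.
have mF k : measurable (F k).
  apply: measurableI; first exact: measurable_first_passage.
  by apply: (measurable_iter_preimage GM); exact: measurable_absgt.
apply: (@le_trans _ _ (\sum_(k < n.+1) Pr (F k))).
  apply: Pr_bigcup_le => // y /EF[k [kn fk ak]].
  by exists k.
rewrite -Pr_bigcup; [|exact: measurable_first_passage|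
                      exact: first_passage_disjoint].
rewrite mulr_sumr; apply: ler_sum => k _.
apply: le_trans (QI (@saturated_first_passage x k) (measurable_absgt _ _)) _.
rewrite -mulrA ler_wpM2l//; first exact: le_trans C0_ge1.
by rewrite mulrC ler_wpM2r ?Pr_ge0// hp// leq_subr.
Qed.

(** An Ottaviani argument: after a passage with [|S_k| > 2x], either [|S_n| > x] or the restarted
    sum travels back more than [x]. The extra [K] in the level makes up for the use of whole
    cylinders. *)
Lemma birkhoff_maximal_inequality n (x p : R) : 0 <= x ->
  (forall m, (m <= n)%N -> Pr (absgt m x) <= p) ->
  Pr (\big[setU/set0]_(k < n.+1) first_passage (2 * x + K) k) <= (1 + C0) * p.
Proof.
move=> x0 hp; set U := (X in Pr X).
have p0 : 0 <= p by apply: le_trans (hp 0%N isT); exact: Pr_ge0.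
have mU : measurable U.
  by apply: bigsetU_measurable => k _; exact: measurable_first_passage.
have mD : measurable (U `\` absgt n x).
  by apply: measurableD => //; exact: measurable_absgt.
apply: (@le_trans _ _ (Pr (absgt n x `|` (U `\` absgt n x)))).
  apply: le_Pr => //; first by apply: measurableU => //; exact: measurable_absgt.
  by move=> y Uy; have [|] := pselect (absgt n x y); [left|right].
apply: le_trans (Pr_setU_le _ (measurable_absgt _ _) mD) _.
rewrite mulrDl mul1r lerD// ?hp//.
apply: le_trans (first_passage_restart (x := 2 * x + K) mD hp _) _.
  move=> y [Uy nx].
  move: Uy; rewrite /U -bigcup_mkord => -[k /= kn fk].
  exists k; split => //.
  have [/sat_absgt Sk _] := fk.
  have := birkhoffD T v k (n - k) y; rewrite subnKC// => Sn.
  move/negP: nx; rewrite -leNgt => nx.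
  rewrite /absgt/=.
  have := ler_normB (S n y) (S (n - k) (iter k T y)).
  have -> : S n y - S (n - k) (iter k T y) = S k y by rewrite Sn addrK.
  move: nx Sk => /=; lra.
rewrite -[leRHS]mulr1 ler_wpM2l//; last exact: Pr_le1.
by rewrite mulr_ge0//; apply: le_trans C0_ge1.
Qed.

Lemma Pr_iter_gt k (x : R) : Pr [set y | x < `|v (iter k T y)|] = Pr [set y | x < `|v y|].
Proof.
apply: (Pr_iter_preimage GM k (A := [set y | x < `|v y|])).
apply: measurable_gt; apply: measurableT_comp mv.
exact: normr_measurable.
Qed.

(** Time 0 is excluded by [S_0 = 0], so there is a time just before the passage; the sum at the
    passage is then controlled up to a single jump. *)
Lemma first_passage_bound (x : R) k y : 0 <= x -> first_passage x k y ->
  exists2 i, k = i.+1 & `|S i y| <= x.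
Proof.
move=> x0 [sk hk]; case: k sk hk => [[z + _] _|k sk hk].
  by rewrite /absgt/= birkhoff0 normr0 ltNge x0.
exists k => //; rewrite leNgt; apply/negP => xk.
by apply: (hk k) => //; exact: sub_sat.
Qed.

Lemma le_absgt k (x x' : R) : x <= x' -> Pr (absgt k x') <= Pr (absgt k x).
Proof.
move=> xx'; apply: le_Pr; [exact: measurable_absgt..|].
by move=> y; apply: le_lt_trans.
Qed.

(* Restart at the first passage over 2x+2K: unless some jump exceeds x, the sum
   has to travel a distance x both before and after that time. *)
Lemma hoffmann_jorgensen n (x p : R) : 2 * K <= x ->
  (forall m, (m <= n)%N -> Pr (absgt m x) <= p) ->
  forall m, (m <= n)%N -> Pr (absgt m (5 * x)) <=
    n%:R * Pr [set y | x < `|v y|] + C0 * (1 + C0) * p ^+ 2.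
Proof.
move=> Kx hp m mn.
have x0 : 0 <= x by apply: le_trans Kx; rewrite mulr_ge0.
have p0 : 0 <= p by apply: le_trans (hp 0%N isT); exact: Pr_ge0.
have mj k : measurable [set y | x < `|v (iter k T y)|].
  apply: (@measurable_gt _ _ _ (fun y => `|v (iter k T y)|)).
  apply: measurableT_comp; first exact: normr_measurable.
  exact: measurable_iterate.
pose F k := [set y | x < `|v (iter k T y)|].
pose B := \big[setU/set0]_(k < n) F k.
have mB : measurable B by apply: bigsetU_measurable => k _; exact: mj.
have mD : measurable (absgt m (5 * x) `\` B).
  by apply: measurableD => //; exact: measurable_absgt.
apply: (@le_trans _ _ (Pr (B `|` (absgt m (5 * x) `\` B)))).
  apply: le_Pr => //; [exact: measurable_absgt|exact: measurableU|].
  by move=> y Uy; have [|] := pselect (B y); [left|right].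
apply: le_trans (Pr_setU_le _ mB mD) _; apply: lerD.
  apply: (@le_trans _ _ (\sum_(k < n) Pr (F k))).
    apply: Pr_bigcup_le => //.
    by move=> y; rewrite /B -bigcup_mkord => -[k /= kn h]; exists k.
  under eq_bigr do rewrite Pr_iter_gt.
  by rewrite sumr_const card_ord mulr_natl.
have hpm i : (i <= m)%N -> Pr (absgt i x) <= p.
  by move=> im; apply: hp; exact: leq_trans mn.
(* A passage over [2x + 2K] ensures [|S_k| > 2x + K], the level of the maximal inequality. Without a
   big jump the sum is at most [(2x + 2K) + x + x <= 5x], since [2K <= x]: this is where the factor
   5 comes from. *)
have xK : 0 <= 2 * x + 2 * K by rewrite addr_ge0 ?mulr_ge0.
apply: le_trans (first_passage_restart (x := 2 * x + 2 * K) mD hpm _) _.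
  move=> y [/= my By].
  have [|k km fk] := @first_passage_exists (2 * x + 2 * K) m y.
    by apply: le_lt_trans my; lra.
  exists k; split => //.
  have [i ki Si] := first_passage_bound xK fk.
  have := birkhoffD T v k (m - k) y; rewrite subnKC// => Sm.
  rewrite /absgt/= ltNge; apply/negP => h.
  have vi : `|v (iter i T y)| <= x.
    rewrite leNgt; apply/negP => h1; apply: By.
    rewrite /B -bigcup_mkord; exists i => //=.
    by rewrite -ki (leq_trans km).
  move: my; rewrite /absgt/= ltNge Sm {1}ki birkhoffSr => /negP; apply.
  apply: le_trans (ler_normD _ _) _.
  apply: le_trans (lerD (ler_normD _ _) h) _; lra.
rewrite [leRHS](_ : _ = C0 * p * ((1 + C0) * p)); last by ring.
rewrite ler_wpM2l//; first by rewrite mulr_ge0//; apply: le_trans C0_ge1.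
apply: le_trans (birkhoff_maximal_inequality x0 hpm).
apply: le_Pr.
- by apply: bigsetU_measurable => k _; exact: measurable_first_passage.
- by apply: bigsetU_measurable => k _; exact: measurable_first_passage.
rewrite -!bigcup_mkord => y [k km [/sat_absgt ky _]].
have [|k' kk' fk'] := @first_passage_exists (2 * x + K) k y; first by lra.
by exists k' => //=; rewrite ltnS (leq_trans kk').
Qed.

End FirstPassage.

Lemma exists_tail_le {R : realType} {d : measure_display}
    {Omega : measurableType d} (mu : probability Omega R) (f : Omega -> R)
    (eta : R) : measurable_fun setT f -> 0 < eta ->
  exists2 x0 : R, 0 < x0 & forall x, x0 <= x -> Pr mu [set y | x < `|f y|] <= eta.
Proof.
move=> mf eta0.
pose F (k : nat) := [set y | k%:R < `|f y|].
have mF (x : R) : measurable [set y | x < `|f y|].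
  apply: (@measurable_gt _ _ _ (fun y => `|f y|)).
  by apply: measurableT_comp => //; exact: normr_measurable.
have F0 : \bigcap_k F k = set0.
  apply/seteqP; split => // y Fy.
  have := Fy (Num.truncn `|f y|).+1 I.
  by rewrite /F/= ltNge ltW// truncnS_gt.
have : mu \o F @ \oo --> mu (\bigcap_k F k).
  apply: nonincreasing_cvg_mu => //.
  - by apply: (le_lt_trans (probability_le1 mu (mF _))); exact: ltry.
  - by move=> i; exact: mF.
  - by apply: bigcapT_measurable => i; exact: mF.
  - apply/nonincreasing_seqP => k; apply/subsetPset => y.
    by apply: le_lt_trans; rewrite ler_nat.
rewrite F0 measure0 => /fine_cvgP[_ /cvgrPdist_le/(_ _ eta0)[k _ /(_ k.+1)]].
move=> /(_ (leqnSn k)); rewrite /= sub0r normrN => h.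
exists k.+1%:R => // x xk; apply: le_trans (le_trans (ler_norm _) h).
by apply: le_Pr; [exact: mF|exact: mF|move=> y; exact: le_lt_trans].
Qed.

(** * Functions with controlled decay along powers of 5 *)

Section Comparator.
Context {R : realType} {Phi : R -> R} {X0 B rho : R}.
Hypothesis X0_gt0 : 0 < X0.
Hypothesis B_ge1 : 1 <= B.
Hypothesis rho01 : 0 < rho < 1.
Hypothesis Phi_gt0 : forall x, X0 <= x -> 0 < Phi x.
Hypothesis Phi_up : forall x y, X0 <= x -> x <= y -> y <= 5 * x -> Phi y <= B * Phi x.
Hypothesis Phi_dn : forall x y, X0 <= x -> x <= y -> y <= 5 * x -> Phi x <= B * Phi y.
Hypothesis Phi_decay : forall x, X0 <= x -> Phi (5 * x) <= rho * Phi x.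

Lemma geometric_scale (x0 x : R) : 0 < x0 -> x0 <= x ->
  exists k x', [/\ x = 5 ^+ k * x', x0 <= x' & x' < 5 * x0].
Proof.
move=> x00.
have key m z : x0 <= z -> z < 5 ^+ m * x0 ->
    exists k x', [/\ z = 5 ^+ k * x', x0 <= x' & x' < 5 * x0].
  elim: m z => [|m IH] z zx zm; first by move: zm; rewrite expr0 mul1r ltNge zx.
  have [z5|z5] := ltP z (5 * x0).
    by exists 0%N, z; rewrite expr0 mul1r.
  have [||k [x' [zE h1 h2]]] := IH (z / 5).
  - by rewrite ler_pdivlMr// mulrC.
  - by rewrite ltr_pdivrMr// mulrAC -exprSr.
  exists k.+1, x'; split => //.
  by rewrite exprS -mulrA -zE mulrC divfK.
move=> xx; apply: (key (Num.truncn (x / x0)).+1) => //.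
rewrite -ltr_pdivrMr//; apply: lt_le_trans (truncnS_gt _) _.
by rewrite -natrX ler_nat ltnW// ltn_expl.
Qed.

Lemma le_5expr (k : nat) (x : R) : 0 <= x -> x <= 5 ^+ k * x.
Proof. by move=> x0; rewrite ler_peMl// exprn_ege1// ler1n. Qed.

Lemma Phi_decay_iter r x : X0 <= x -> Phi (5 ^+ r * x) <= rho ^+ r * Phi x.
Proof.
move=> xX; elim: r => [|r IH]; first by rewrite !expr0 !mul1r.
rewrite !exprS -!mulrA; apply: le_trans (Phi_decay _) _.
  by apply: le_trans (xX) (le_5expr _ _); exact: le_trans (ltW X0_gt0) xX.
by rewrite ler_wpM2l//; case/andP: rho01 => /ltW.
Qed.

(** Decay by [rho] is known only for the exact factor 5; the leftover factor below 5 costs one [B]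
    through [Phi_up]. *)
Lemma Phi_far r x y : X0 <= x -> 5 ^+ r * x <= y ->
  Phi y <= B * rho ^+ r * Phi x.
Proof.
case/andP: rho01 => r0 r1 xX xy.
have x0 : 0 < x by exact: lt_le_trans xX.
have Xr : X0 <= 5 ^+ r * x by apply: le_trans xX (le_5expr _ (ltW x0)).
have rx0 : 0 < 5 ^+ r * x by exact: lt_le_trans Xr.
have [k [x' [-> h1 h2]]] := geometric_scale rx0 xy.
have Xx' : X0 <= x' by exact: le_trans h1.
apply: le_trans (Phi_decay_iter _ Xx') _.
apply: (@le_trans _ _ (Phi x')).
  by rewrite ler_piMl ?exprn_ile1 ?(ltW (Phi_gt0 _)) // ltW.
apply: le_trans (Phi_up Xr h1 (ltW h2)) _.
rewrite -mulrA ler_wpM2l//; first exact: le_trans B_ge1.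
exact: Phi_decay_iter.
Qed.

Lemma Phi_near r x y : X0 <= x -> x <= y -> y <= 5 ^+ r * x ->
  Phi x <= B ^+ r * Phi y.
Proof.
have B0 : 0 <= B by exact: le_trans B_ge1.
elim: r x => [|r IH] x xX xy yx.
  suff -> : x = y by rewrite expr0 mul1r.
  by apply/eqP; rewrite eq_le xy; move: yx; rewrite expr0 mul1r.
have x0 : 0 < x by exact: lt_le_trans xX.
have [y5|y5] := leP y (5 * x).
  apply: le_trans (Phi_dn xX xy y5) _; rewrite ler_wpM2r//.
    by rewrite ltW// Phi_gt0// (le_trans xX).
  by rewrite exprS ler_peMr// exprn_ege1.
have x5 : x <= 5 * x by rewrite ler_peMl ?ler1n// ltW.
apply: le_trans (Phi_dn xX x5 (lexx _)) _.
rewrite exprS -mulrA ler_wpM2l//; apply: IH.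
- exact: le_trans x5.
- exact: ltW.
- by rewrite mulrA -exprSr.
Qed.

Lemma exists_expr_le (c eps : R) : 0 <= c -> 0 < eps ->
  exists r, c * rho ^+ r <= eps.
Proof.
case/andP: rho01 => r0 r1 c0 eps0.
have c1 : 0 < c + 1 by rewrite ltr_wpDl.
have : rho ^+ n @[n --> \oo] --> (0 : R) by apply: cvg_expr; rewrite ger0_norm// ltW.
move=> /cvgrPdist_le/(_ _ (divr_gt0 eps0 c1))[r _ /(_ r (leqnn r))].
rewrite sub0r normrN (ger0_norm (exprn_ge0 _ (ltW r0))) => h; exists r.
move: h; rewrite ler_pdivlMr// mulrC; apply: le_trans.
by rewrite ler_wpM2r ?exprn_ge0 ?lerDl// ltW.
Qed.

Context {a : nat -> R}.
Hypothesis a_infty : a n @[n --> \oo] --> +oo.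
Hypothesis Phi_a : n%:R * Phi (a n) @[n --> \oo] --> (1 : R).

Lemma near_a_ge (x : R) : \forall n \near \oo, x <= a n.
Proof. by move/cvgryPge : a_infty; exact. Qed.

Lemma near_Phi_a : \forall n \near \oo, 2^-1 <= n%:R * Phi (a n) <= 2.
Proof.
have h0 : 0 < 2^-1 :> R by [].
move/cvgrPdist_le : Phi_a => /(_ _ h0); apply: filterS => n.
rewrite ler_norml => /andP[h1 h2]; apply/andP; split; lra.
Qed.

(** If [a m > 5^r a n] with [m <= n], then [m Phi(a m) <= n Phi(a m) <= B rho^r n Phi(a n)]. With
    [B rho^r <= 1/8] this is at most 1/4, against the lower bound 1/2 near the limit 1. *)
Lemma a_almost_monotone : exists r n0, forall m n, (n0 <= m)%N -> (m <= n)%N ->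
  a m <= 5 ^+ r * a n.
Proof.
have B0 : 0 <= B by exact: le_trans B_ge1.
have e0 : 0 < 8^-1 :> R by [].
have [r hr] := exists_expr_le B0 e0.
have [n0 _ H] : \forall n \near \oo, (X0 <= a n) /\ (2^-1 <= n%:R * Phi (a n) <= 2).
  by near=> n; split; near: n; [exact: near_a_ge|exact: near_Phi_a].
exists r, n0 => m n n0m mn.
have [Xm /andP[m1 m2]] := H m n0m.
have [Xn /andP[n1 n2]] := H n (leq_trans n0m mn).
rewrite leNgt; apply/negP => am.
have /= := Phi_far Xn (ltW am).
move=> h; have : m%:R * Phi (a m) <= n%:R * Phi (a m).
  by rewrite ler_wpM2r ?ler_nat// ltW// Phi_gt0.
have : n%:R * Phi (a m) <= n%:R * (B * rho ^+ r * Phi (a n)) by rewrite ler_wpM2l.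
have : B * rho ^+ r * (n%:R * Phi (a n)) <= 8^-1 * 2.
  rewrite ler_pM// ?mulr_ge0// ?exprn_ge0//; first by case/andP: rho01 => /ltW.
  by rewrite ltW// Phi_gt0.
set t := B * rho ^+ r; set f := Phi (a n); set g := Phi (a m); set nr := n%:R.
have -> : t * (nr * f) = nr * (t * f) by rewrite mulrCA.
rewrite -/g in m1 => h1 h2 h3.
have := le_trans m1 (le_trans h3 (le_trans h2 h1)); lra.
Unshelve. all: by end_near. Qed.

End Comparator.

(** * Large deviation bound up to a constant *)

Section TailBound.
Context {R : realType} {d : measure_display} {Omega : measurableType d}.
Context {J : countType} {mu : probability Omega R} {T : Omega -> Omega}.
Context {P : J -> set Omega} {theta : R}.
Hypothesis GM : GibbsMarkov mu T P theta.
Context {v : Omega -> R}.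
Hypothesis mv : measurable_fun setT v.
Hypothesis v_lip : exists K : R, forall j, Dj_le P T theta v j K.
Context {Phi : R -> R} {X0 A0 B rho : R}.
Hypothesis X0_gt0 : 0 < X0.
Hypothesis A0_ge0 : 0 <= A0.
Hypothesis B_ge1 : 1 <= B.
Hypothesis rho01 : 0 < rho < 1.
Hypothesis Phi_gt0 : forall x, X0 <= x -> 0 < Phi x.
Hypothesis Phi_v : forall x, X0 <= x -> Pr mu [set y | x < `|v y|] <= A0 * Phi x.
Hypothesis Phi_up : forall x y, X0 <= x -> x <= y -> y <= 5 * x -> Phi y <= B * Phi x.
Hypothesis Phi_dn : forall x y, X0 <= x -> x <= y -> y <= 5 * x -> Phi x <= B * Phi y.
Hypothesis Phi_decay : forall x, X0 <= x -> Phi (5 * x) <= rho * Phi x.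
Context {a : nat -> R}.
Hypothesis a_gt0 : forall n, 0 < a n.
Hypothesis a_infty : a n @[n --> \oo] --> +oo.
Hypothesis Phi_a : n%:R * Phi (a n) @[n --> \oo] --> (1 : R).

Local Notation Pr := (Pr mu).
Local Notation absgt := (absgt T v).

Hypothesis tight : forall eta : R, 0 < eta ->
  exists M : R, \forall n \near \oo, Pr (absgt n (M * a n)) <= eta.

(** Tightness at time [m] is at the scale [a m]; almost monotonicity carries it to the scale [a n].
    The finitely many small [m] have fixed laws, while [a n] tends to infinity. *)
Lemma uniform_tight (eta : R) : 0 < eta -> exists2 M : R, 1 <= M &
  \forall n \near \oo, forall m, (m <= n)%N -> Pr (absgt m (M * a n)) <= eta.
Proof.
move=> eta0; have [M1 [n1 _ H1]] := tight eta0.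
have [r [n2 H2]] := a_almost_monotone X0_gt0 B_ge1 rho01 Phi_gt0 Phi_up
  Phi_decay a_infty Phi_a.
pose n3 := maxn n1 n2.
have [X HX] : exists X : R, forall m, (m < n3)%N -> Pr (absgt m X) <= eta.
  elim: n3 => [|k [X HX]]; first by exists 0.
  have [x0 _ Hx0] := exists_tail_le mu (measurable_birkhoff GM mv k) eta0.
  exists (Num.max X x0) => m; rewrite ltnS leq_eqVlt => /orP[/eqP ->|mk].
    by apply: Hx0; rewrite le_max lexx orbT.
  apply: le_trans (HX _ mk); apply: (le_absgt GM mv).
  by rewrite le_max lexx.
pose M2 := Num.max M1 1.
have M21 : 1 <= M2 by rewrite le_max lexx orbT.
exists (M2 * 5 ^+ r).
  by rewrite mulr_ege1// exprn_ege1// ler1n.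
have M20 : 0 <= M2 by exact: le_trans M21.
near=> n => m mn; have [mn3|mn3] := ltnP m n3.
  apply: le_trans (HX _ mn3); apply: (le_absgt GM mv).
  apply: (@le_trans _ _ (a n)); first by near: n; exact: near_a_ge.
  by rewrite ler_peMl ?(ltW (a_gt0 _))// mulr_ege1// exprn_ege1// ler1n.
have [mn1 mn2] : (n1 <= m)%N /\ (n2 <= m)%N.
  by move: mn3; rewrite /n3 geq_max => /andP[].
apply: le_trans (H1 m mn1); apply: (le_absgt GM mv).
apply: (@le_trans _ _ (M2 * a m)).
  by rewrite ler_wpM2r ?(ltW (a_gt0 _))// le_max lexx.
by rewrite -mulrA ler_wpM2l// H2.
Unshelve. all: by end_near. Qed.

(* Iterating the Hoffmann-Jorgensen inequality along x, 5x, 25x, ... the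
   quadratic term is absorbed, leaving a multiple of n Phi plus a remainder
   that decreases by a factor B at each step, i.e. at least as fast as Phi. *)
Lemma large_deviation_bound : exists A M : R, [/\ 0 <= A, 1 <= M &
  \forall n \near \oo, forall m x, (m <= n)%N -> M * a n <= x ->
    Pr (absgt m x) <= A * (n%:R * Phi x)].
Proof.
have B0 : 0 < B by exact: lt_le_trans B_ge1.
have [C0 C01 QI] := quasi_independence GM.
have [K1 v_lip1] := v_lip.
pose K0 : R := `|K1|.
have K00 : 0 <= K0 by exact: normr_ge0.
have v_lip0 j : Dj_le P T theta v j K0.
  move=> y y' yj yj' yy'; apply: le_trans (v_lip1 j _ _ yj yj' yy') _.
  by rewrite ler_wpM2r ?ler_norm// (dtheta_ge0 GM).
pose K := K0 / (1 - theta).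
have HJ := hoffmann_jorgensen GM mv K00 v_lip0 C01 QI (erefl K).
pose C1 := C0 * (1 + C0); rewrite -/C1 in HJ.
have C00 : 0 < C0 by exact: lt_le_trans C01.
have C10 : 0 < C1 by rewrite mulr_gt0// addr_gt0.
clearbody C1.
(* For [0 <= e <= eta] the term [2 C1 e^2] is at most [e / B], so the remainder shrinks by [B] at
   each step. *)
pose eta := (2 * C1 * B)^-1.
have eta0 : 0 < eta by rewrite invr_gt0 !mulr_gt0.
have [M0 M01 HM0] := uniform_tight eta0.
(* In [A0 + 1] the jump term takes [A0] and the square of the [Phi] part takes 1; the factor [B]
   pays for moving [Phi] from [x] to [5x]. *)
have [A Adef A1] : exists2 A, A = B * (A0 + 1) & 0 < A.
  by exists (B * (A0 + 1)) => //; rewrite mulr_gt0// ltr_wpDl.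
(* Once [q = n Phi] is at most [eps], the term [2 C1 A^2 q^2] is at most [q]. *)
pose eps := (2 * C1 * A ^+ 2)^-1.
have eps0 : 0 < eps by rewrite invr_gt0 !mulr_gt0// exprn_gt0.
have BB0 : 0 <= B * 2 by rewrite mulr_ge0// ltW.
have [r hr] := exists_expr_le rho01 BB0 eps0.
(* Beyond [M0 a_n] the starting bound [eta] holds; beyond [5^r a_n] the value [n Phi] is below
   [eps]. *)
pose M := Num.max M0 (5 ^+ r).
have M1 : 1 <= M by rewrite le_max M01.
have M00 : 0 < M by exact: lt_le_trans M1.
pose s := (Num.truncn (5 * M)).+1.
have hs : 5 * M <= 5 ^+ s.
  apply: le_trans (ltW (truncnS_gt _)) _.
  by rewrite -natrX ler_nat ltnW// ltn_expl.
exists (A + 2 * eta * B ^+ s), M; split => //.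
  by rewrite addr_ge0 ?mulr_ge0 ?exprn_ge0// ltW.
near=> n => m x mn Mx.
have anX : X0 <= a n by near: n; exact: near_a_ge.
have anK : 2 * K <= a n by near: n; exact: near_a_ge.
have /andP[Pa1 Pa2] : 2^-1 <= n%:R * Phi (a n) <= 2.
  by near: n; exact: near_Phi_a.
have Htight : forall m, (m <= n)%N -> Pr (absgt m (M0 * a n)) <= eta.
  by near: n.
have an0 := a_gt0 n.
have Man0 : 0 < M * a n by rewrite mulr_gt0.
have aMa : a n <= M * a n by rewrite ler_peMl// ltW.
have qeps y : M * a n <= y -> n%:R * Phi y <= eps.
  move=> My; have ry : 5 ^+ r * a n <= y.
    by apply: le_trans My; rewrite ler_wpM2r ?(ltW an0)// le_max lexx orbT.
  have h := Phi_far X0_gt0 B_ge1 rho01 Phi_gt0 Phi_up Phi_decay anX ry.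
  apply: le_trans (ler_wpM2l (ler0n _ n) h) _.
  rewrite mulrCA; apply: le_trans hr.
  rewrite [leRHS]mulrAC ler_wpM2l// ?mulr_ge0 ?exprn_ge0// ?ltW//.
  by case/andP: rho01.
have [k [x' [-> Mx' x'M]]] := geometric_scale Man0 Mx.
have x'0 : 0 < x' by exact: lt_le_trans Mx'.
have Mk j : M * a n <= 5 ^+ j * x'.
  by apply: le_trans Mx' (le_5expr _ (ltW _)).
have Xk j : X0 <= 5 ^+ j * x' by apply: le_trans (Mk j); exact: le_trans aMa.
have key j : forall m, (m <= n)%N ->
    Pr (absgt m (5 ^+ j * x')) <= A * (n%:R * Phi (5 ^+ j * x')) + eta / B ^+ j.
  elim: j => [|j IH] i iN.
    rewrite !expr0 mul1r divr1.
    apply: (@le_trans _ _ eta).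
      apply: le_trans (Htight i iN); apply: (le_absgt GM mv).
      by apply: le_trans Mx'; rewrite ler_wpM2r ?(ltW an0)// le_max lexx.
    rewrite lerDr !mulr_ge0 ?(ltW A1)// ltW// Phi_gt0//.
    by have := Xk 0%N; rewrite expr0 mul1r.
  rewrite [in leLHS]exprS -mulrA.
  have Kx : 2 * K <= 5 ^+ j * x'.
    by apply: le_trans (Mk j); apply: le_trans aMa.
  apply: le_trans (HJ _ _ _ Kx IH _ iN) _.
  have vq : n%:R * Pr [set y | 5 ^+ j * x' < `|v y|] <=
      A0 * (n%:R * Phi (5 ^+ j * x')).
    by rewrite mulrCA ler_wpM2l// Phi_v.
  set q := n%:R * Phi (5 ^+ j * x') in vq *.
  have q0 : 0 <= q by rewrite mulr_ge0// ltW// Phi_gt0.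
  have qe : q <= eps by exact: qeps.
  have qS : q <= B * (n%:R * Phi (5 ^+ j.+1 * x')).
    rewrite mulrCA ler_wpM2l// exprS -mulrA Phi_dn//.
    by rewrite ler_peMl ?ler1n// (le_trans (ltW X0_gt0)).
  set e := eta / B ^+ j.
  have Bj0 : 0 < B ^+ j by rewrite exprn_gt0.
  have e0 : 0 <= e by rewrite divr_ge0// ltW.
  have ee : e <= eta by rewrite ler_pdivrMr// ler_peMr ?(ltW eta0)// exprn_ege1.
  have eS : eta / B ^+ j.+1 = e / B by rewrite /e exprSr invfM mulrA.
  rewrite eS; clearbody e q.
  have c1 : C1 * 2 * A ^+ 2 * q ^+ 2 <= q.
    have -> : C1 * 2 * A ^+ 2 = eps^-1 by rewrite /eps invrK; ring.
    by rewrite expr2 mulrA ler_piMl// mulrC ler_pdivrMr// mul1r.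
  have c2 : C1 * 2 * e ^+ 2 <= e / B.
    have -> : C1 * 2 = (B * eta)^-1.
      rewrite /eta invfM invrK; field.
      by rewrite gt_eqF.
    have -> : (B * eta)^-1 * e ^+ 2 = e / B * (e / eta) by rewrite invfM; ring.
    by rewrite ler_piMr ?divr_ge0 ?(ltW B0)// ler_pdivrMr// mul1r.
  have sq : (A * q + e) ^+ 2 <= 2 * A ^+ 2 * q ^+ 2 + 2 * e ^+ 2.
    by have := sqr_ge0 (A * q - e); rewrite !expr2; lra.
  have AE : A * (n%:R * Phi (5 ^+ j.+1 * x')) =
      (A0 + 1) * (B * (n%:R * Phi (5 ^+ j.+1 * x'))).
    by rewrite Adef; ring.
  rewrite AE.
  have := ler_wpM2l (ltW C10) sq.
  have A01 : 0 <= A0 + 1 by rewrite addr_ge0.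
  have := ler_wpM2l A01 qS.
  move: c1 c2 vq.
  set t := C1 * (A * q + e) ^+ 2; set w := n%:R * Pr _.
  set z := (A0 + 1) * (B * _); set eB := e / B.
  lra.
apply: le_trans (key k m mn) _; rewrite mulrDl lerD2l.
(* The remainder [eta / B^k] is absorbed here: [x'] lies between [a n] and [5^s a n], so
   [n Phi(x') >= B^-s / 2], and [k] further factors 5 divide [Phi] by at most [B^k]. *)
have Pk : Phi x' <= B ^+ k * Phi (5 ^+ k * x').
  have Xx' : X0 <= x' by have := Xk 0%N; rewrite expr0 mul1r.
  exact: (Phi_near X0_gt0 B_ge1 Phi_gt0 Phi_dn Xx' (le_5expr _ (ltW _))).
have Pn : Phi (a n) <= B ^+ s * Phi x'.
  apply: (Phi_near X0_gt0 B_ge1 Phi_gt0 Phi_dn anX).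
    exact: le_trans Mx'.
  apply: le_trans (ltW x'M) _; rewrite mulrA ler_wpM2r ?(ltW an0)//.
rewrite ler_pdivrMr ?exprn_gt0//.
rewrite -[leLHS]mulr1 -!mulrA [2 * _]mulrCA ler_wpM2l ?(ltW eta0)//.
have : 2^-1 <= B ^+ s * (n%:R * Phi (5 ^+ k * x') * B ^+ k).
  apply: le_trans Pa1 _.
  apply: le_trans (ler_wpM2l (ler0n _ n) Pn) _.
  rewrite mulrCA ler_wpM2l ?exprn_ge0 ?(ltW B0)//.
  by rewrite -mulrA ler_wpM2l// mulrC.
lra.
Unshelve. all: by end_near. Qed.

Context {N : nat -> R}.
Hypothesis N_far : N n / a n @[n --> \oo] --> +oo.

Lemma near_N_ge (c : R) : \forall n \near \oo, c * a n <= N n.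
Proof.
move/cvgryPge : N_far => /(_ c); apply: filterS => n.
by rewrite ler_pdivlMr.
Qed.

(** Fractions of [N] are needed because the single-jump argument cuts [N] into small pieces; [c N]
    still dominates [a_n], and changing the level back to [N] costs a fixed power of [B]. *)
Lemma large_deviation_scaled (c : R) : 0 < c -> c <= 1 -> exists2 A : R, 0 <= A &
  \forall n \near \oo, forall m, (m <= n)%N ->
    Pr (absgt m (c * N n)) <= A * (n%:R * Phi (N n)).
Proof.
move=> c0 c1; have [A [M [A_ge0 M1 HM]]] := large_deviation_bound.
pose r := (Num.truncn c^-1).+1.
have hr : c^-1 <= 5 ^+ r.
  apply: le_trans (ltW (truncnS_gt _)) _.
  by rewrite -natrX ler_nat ltnW// ltn_expl.
exists (A * B ^+ r).
  by rewrite mulr_ge0// exprn_ge0//; exact: le_trans B_ge1.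
near=> n => m mn.
have Ma : M * a n <= c * N n.
  rewrite -ler_pdivrMl// mulrA; near: n; exact: near_N_ge.
have aX : X0 <= a n by near: n; exact: near_a_ge.
have cX : X0 <= c * N n.
  apply: le_trans Ma; apply: le_trans aX _.
  by rewrite ler_peMl// ltW.
have N0 : 0 <= N n.
  by rewrite -(pmulr_rge0 _ c0); apply: le_trans cX; exact: ltW.
have H : forall m x, (m <= n)%N -> M * a n <= x ->
    Pr (absgt m x) <= A * (n%:R * Phi x) by near: n.
apply: le_trans (H m _ mn Ma) _; rewrite -mulrA ler_wpM2l// mulrCA ler_wpM2l//.
apply: (Phi_near X0_gt0 B_ge1 Phi_gt0 Phi_dn cX); first by rewrite ler_piMl.
rewrite mulrA ler_peMl// -ler_pdivrMr// mul1r.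
Unshelve. all: by end_near. Qed.

Lemma nPhi_N_cvg0 : n%:R * Phi (N n) @[n --> \oo] --> (0 : R).
Proof.
apply/cvgrPdist_le => e e0.
have BB0 : 0 <= B * 2 by rewrite mulr_ge0//; exact: le_trans B_ge1.
have [r hr] := exists_expr_le rho01 BB0 e0.
near=> n.
have aX : X0 <= a n by near: n; exact: near_a_ge.
have aN : 5 ^+ r * a n <= N n by near: n; exact: near_N_ge.
have /andP[_ Pa2] : 2^-1 <= n%:R * Phi (a n) <= 2.
  by near: n; exact: near_Phi_a.
have NX : X0 <= N n.
  by apply: le_trans aN; apply: le_trans aX (le_5expr _ (ltW (a_gt0 _))).
rewrite sub0r normrN ger0_norm; last by rewrite mulr_ge0// ltW// Phi_gt0.
have h := Phi_far X0_gt0 B_ge1 rho01 Phi_gt0 Phi_up Phi_decay aX aN.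
apply: le_trans (ler_wpM2l (ler0n _ n) h) _.
rewrite mulrCA; apply: le_trans hr.
rewrite [leRHS]mulrAC ler_wpM2l// mulr_ge0//; first exact: le_trans B_ge1.
by rewrite exprn_ge0//; case/andP: rho01 => /ltW.
Unshelve. all: by end_near. Qed.

End TailBound.

(** * One big jump: upper and lower estimates at a fixed level *)

Section SingleJump.
Context {R : realType} {d : measure_display} {Omega : measurableType d}.
Context {J : countType} {mu : probability Omega R} {T : Omega -> Omega}.
Context {P : J -> set Omega} {theta : R}.
Hypothesis GM : GibbsMarkov mu T P theta.
Context {v : Omega -> R} {K0 C0 K : R}.
Hypothesis mv : measurable_fun setT v.
Hypothesis K0_ge0 : 0 <= K0.
Hypothesis v_lip : forall j, Dj_le P T theta v j K0.
Hypothesis C0_ge1 : 1 <= C0.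
Hypothesis QI : forall k U B, saturated T P k U -> measurable B ->
  Pr mu (U `&` iter k T @^-1` B) <= C0 * (Pr mu U * Pr mu B).
Hypothesis K_def : K = K0 / (1 - theta).

Local Notation Pr := (Pr mu).
Local Notation S := (birkhoff T v).
Local Notation absgt := (absgt T v).
Local Notation sat := (sat T P).
Local Notation first_passage := (first_passage T P v).
Local Notation same := (same_cylinder T P).

Let K_ge0 : 0 <= K.
Proof.
have [_ _ _ [[_ _ _ _ /andP[t0 t1]] _]] := GM.
by rewrite K_def divr_ge0// subr_ge0 ltW.
Qed.

Let C0_ge0 : 0 <= C0. Proof. exact: le_trans C0_ge1. Qed.

Let mvgt x : measurable [set y | x < v y].
Proof. exact: measurable_gt. Qed.

Let mitergt k x : measurable [set y | x < v (iter k T y)].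
Proof.
exact: (measurable_gt x (measurable_iterate GM mv k)).
Qed.

Let mSgt n x : measurable [set y | x < S n y].
Proof. exact: (measurable_gt x (measurable_birkhoff GM mv n)). Qed.

Let mabsv (x : R) : measurable [set y | x < `|v y|].
Proof.
apply: (@measurable_gt _ _ _ (fun y => `|v y|)).
by apply: measurableT_comp => //; exact: normr_measurable.
Qed.

Lemma Pr_itergt k x : Pr [set y | x < v (iter k T y)] = Pr [set y | x < v y].
Proof. exact: (Pr_iter_preimage GM k (mvgt x)). Qed.

(** Put [gamma N = 12x], so [K <= 2x]. If no jump exceeds [(1 - gamma) N], the sum before the
    passage over [2x + K] and one jump leave more than [10x - K >= x] to the restarted sum. A
    passage and a second large sum are both needed, hence the square. *)
Lemma jump_upper n (N gamma p : R) : 0 < gamma < 1 -> 6 * K <= gamma * N ->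
  (forall m, (m <= n)%N -> Pr (absgt m (gamma * N / 12)) <= p) ->
  Pr [set y | N < S n y] <=
    n%:R * Pr [set y | (1 - gamma) * N < v y] + C0 * (1 + C0) * p ^+ 2.
Proof.
move=> /andP[g0 g1] KN hp; set x := gamma * N / 12 in hp *.
have gN : gamma * N = 12 * x by rewrite /x; lra.
have x0 : 0 <= x by have := K_ge0; lra.
have N0 : 0 <= N.
  by rewrite -(pmulr_rge0 _ g0) gN mulr_ge0.
have gNN : gamma * N <= N by rewrite ler_piMl// ltW.
clearbody x.
have p0 : 0 <= p by apply: le_trans (hp 0%N isT); exact: Pr_ge0.
pose F k := [set y | (1 - gamma) * N < v (iter k T y)].
pose B := \big[setU/set0]_(k < n) F k.
have mB : measurable B by apply: bigsetU_measurable => k _; exact: mitergt.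
have mD : measurable ([set y | N < S n y] `\` B) by exact: measurableD.
apply: (@le_trans _ _ (Pr (B `|` ([set y | N < S n y] `\` B)))).
  apply: le_Pr => //; first exact: measurableU.
  by move=> y Uy; have [|] := pselect (B y); [left|right].
apply: le_trans (Pr_setU_le _ mB mD) _; apply: lerD.
  apply: (@le_trans _ _ (\sum_(k < n) Pr (F k))).
    apply: Pr_bigcup_le => //; first by move=> k; exact: mitergt.
    by move=> y; rewrite /B -bigcup_mkord => -[k /= kn h]; exists k.
  under eq_bigr do rewrite Pr_itergt.
  by rewrite sumr_const card_ord mulr_natl.
have xK : 0 <= 2 * x + K by rewrite addr_ge0 ?mulr_ge0.
apply: le_trans (first_passage_restart GM mv C0_ge1 QI (x := 2 * x + K) mD hp _) _.
  move=> y [/= Ny By].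
  have [|k kn fk] := @first_passage_exists _ _ _ _ _ _ _ _ GM v (2 * x + K) n y.
    by apply: lt_le_trans (ler_norm _); apply: le_lt_trans Ny; lra.
  exists k; split => //.
  have [i ki Si] := first_passage_bound GM xK fk.
  have := birkhoffD T v k (n - k) y; rewrite subnKC// => Sn.
  have vi : v (iter i T y) <= (1 - gamma) * N.
    rewrite leNgt; apply/negP => h1; apply: By.
    by rewrite /B -bigcup_mkord; exists i => //=; rewrite -ki.
  rewrite /absgt/=; apply: lt_le_trans (ler_norm _).
  move: Ny; rewrite Sn {1}ki birkhoffSr.
  move: Si; rewrite ler_norml => /andP[_ Si].
  set u := S (n - k) _; lra.
rewrite [leRHS](_ : _ = C0 * p * ((1 + C0) * p)); last by ring.
rewrite ler_wpM2l//; first by rewrite mulr_ge0.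
exact (birkhoff_maximal_inequality GM mv K0_ge0 v_lip C0_ge1 QI K_def x0 hp).
Qed.

(** Extends quasi-independence to pasts that are not unions of cylinders: [U] is the same event at a
    slightly lower level, which absorbs the enlargement to whole cylinders. *)
Lemma past_independence k (E U B : set Omega) :
  measurable E -> measurable U -> measurable B -> sat k E `<=` U ->
  Pr (E `&` iter k T @^-1` B) <= C0 * (Pr U * Pr B).
Proof.
move=> mE mU mB EU.
have sE : saturated T P k (sat k E) by exact: (saturated_sat GM (leqnn k)).
have mTB := measurable_iter_preimage GM k mB.
have msE := measurable_saturated GM sE.
apply: (@le_trans _ _ (Pr (sat k E `&` iter k T @^-1` B))).
  apply: le_Pr; [exact: measurableI..|].
  by apply: setSI; exact: (sub_sat GM).
apply: le_trans (QI sE mB) _.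
by rewrite ler_wpM2l// ler_wpM2r ?Pr_ge0// le_Pr.
Qed.

Lemma jump_same k l y z x : same k y z -> (l < k)%N ->
  x < v (iter l T z) -> x - K < v (iter l T y).
Proof.
move=> yz lk xz.
have lyz : same 1 (iter l T y) (iter l T z).
  move=> [|//] _; apply/distinct_atP.
  by have /distinct_atP := yz l lk.
have := birkhoff_same GM K0_ge0 v_lip K_def lyz.
rewrite !birkhoff1 ler_norml => /andP[h _]; lra.
Qed.

(** The events [G k] (first big jump at time [k], and [S_n > N]) are disjoint parts of [S_n > N]. A
    big jump outside [G k] comes with a second rare event: an earlier big jump, a sum over [4x]
    before it, or one over [4x] after it; otherwise the loss is at most [8x], less than the margin
    [gamma N = 12x]. Summed over [k], each coincidence costs at most [C0 p^2]. *)
Lemma jump_lower n (N gamma p : R) : 0 < gamma -> 6 * K <= gamma * N ->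
  (forall m, (m <= n)%N -> Pr (absgt m (gamma * N / 12)) <= p) ->
  n%:R * Pr [set y | N < `|v y|] <= p ->
  n%:R * Pr [set y | (1 + gamma) * N < v y] <=
    Pr [set y | N < S n y] + 3 * C0 * p ^+ 2.
Proof.
move=> g0 KN hp hv; set x := gamma * N / 12 in hp *.
have gN : gamma * N = 12 * x by rewrite /x; lra.
have x0 : 0 <= x by have := K_ge0; lra.
clearbody x.
have p0 : 0 <= p by apply: le_trans (hp 0%N isT); exact: Pr_ge0.
pose E := [set y | N < S n y].
pose B := [set y | (1 + gamma) * N < v y].
pose F k := [set y | (1 + gamma) * N < v (iter k T y)].
have mF k : measurable (F k) by exact: mitergt.
pose W k := \big[setU/set0]_(l < k) F l.
have mW k : measurable (W k) by exact: bigsetU_measurable.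
pose G k := (F k `&` E) `\` W k.
have mE : measurable E by exact: mSgt.
have mG k : measurable (G k) by apply: measurableD => //; exact: measurableI.
have tG : trivIset setT G.
  move=> i j _ _ [y [[[Fi _] Wi] [[Fj _] Wj]]].
  case: (ltngtP i j) => // ij; exfalso.
    by apply: Wj; rewrite /W -bigcup_mkord; exists i.
  by apply: Wi; rewrite /W -bigcup_mkord; exists j.
have GE : \sum_(k < n) Pr (G k) <= Pr E.
  rewrite Pr_bigcup//; apply: le_Pr => //; first exact: bigsetU_measurable.
  by rewrite -bigcup_mkord => y [k _ [[]]].
have vN x' : N <= x' -> n%:R * Pr [set y | x' < v y] <= p.
  move=> Nx'; apply: le_trans hv; rewrite ler_wpM2l// le_Pr// => y /= xy.
  by apply: lt_le_trans (ler_norm _); exact: le_lt_trans xy.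
have BN : n%:R * Pr B <= p by apply: vN; lra.
(* Whole cylinders lower the jump level by [K]; it stays above [N] because [6K <= gamma N]. *)
have BKN : n%:R * Pr [set y | (1 + gamma) * N - K < v y] <= p.
  by apply: vN; have := K_ge0; lra.
have key k : (k < n)%N -> Pr (F k) <= Pr (G k) + C0 * (p * Pr B) +
    (C0 * (p * Pr B) + C0 * (Pr [set y | (1 + gamma) * N - K < v y] * p)).
  move=> kn.
  pose H1 := W k `&` iter k T @^-1` B.
  pose H2 := absgt k (4 * x) `&` iter k T @^-1` B.
  (* Here the jump plays the past and the later sum the future, so the restart is one step after
     time [k]. *)
  pose H3 := iter k T @^-1` (B `&` iter 1 T @^-1` absgt (n - k.+1) (4 * x)).
  have mB : measurable B by exact: mvgt.
  have mTB := measurable_iter_preimage GM k mB.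
  have mH1 : measurable H1 by exact: measurableI.
  have mS m : measurable (absgt m (4 * x)) by exact: (measurable_absgt GM).
  have mH2 : measurable H2 by exact: measurableI.
  have mH3' : measurable (B `&` iter 1 T @^-1` absgt (n - k.+1) (4 * x)).
    by apply: measurableI => //; exact: (measurable_iter_preimage GM).
  have mH3 : measurable H3 by exact: (measurable_iter_preimage GM).
  have sub : F k `<=` (G k `|` H1) `|` (H2 `|` H3).
    move=> y Fy.
    have [Wy|Wy] := pselect (W k y); first by left; right; split.
    have [Ey|Ey] := pselect (E y); first by left; left; split.
    right; have [Sk|Sk] := pselect (absgt k (4 * x) y); first by left.
    right; split => //; rewrite /preimage/= -iterS /absgt/= ltNge.
    apply/negP => h; apply: Ey; rewrite /E/=.
    have := birkhoffD T v k.+1 (n - k.+1) y; rewrite subnKC// birkhoffSr => ->.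
    move/negP: Sk; rewrite /absgt/= -leNgt => Sk.
    move: Fy; rewrite /F/=; move: Sk h; rewrite !ler_norml.
    move=> /andP[Sk _] /andP[h _] Fy.
    move: h Fy; set u := S (n - k.+1) _ => h Fy.
    lra.
  apply: (@le_trans _ _ (Pr ((G k `|` H1) `|` (H2 `|` H3)))).
    by apply: le_Pr => //; do 2 apply: measurableU => //; exact: measurableU.
  apply: le_trans (Pr_setU_le _ (measurableU _ _ (mG k) mH1)
    (measurableU _ _ mH2 mH3)) _.
  apply: lerD.
    apply: le_trans (Pr_setU_le _ (mG k) mH1) _; rewrite lerD2l.
    pose V l := [set y | (1 + gamma) * N - K < v (iter l T y)].
    pose U := \big[setU/set0]_(l < k) V l.
    have mU : measurable U by apply: bigsetU_measurable => l _; exact: mitergt.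
    apply: le_trans (past_independence (mW k) mU mB _) _.
      move=> y [z]; rewrite /W /U -!bigcup_mkord => -[l /= lk Fl] yz.
      by exists l => //=; exact: jump_same yz lk Fl.
    rewrite ler_wpM2l// ler_wpM2r ?Pr_ge0//.
    apply: le_trans BKN.
    apply: (@le_trans _ _ (\sum_(l < k) Pr (V l))).
      apply: Pr_bigcup_le => // [l|y]; first exact: mitergt.
      by rewrite /U -bigcup_mkord => -[l /= lk h]; exists l.
    under eq_bigr do rewrite Pr_itergt.
    rewrite sumr_const card_ord -[leLHS]mulr_natl.
    by rewrite ler_wpM2r ?Pr_ge0// ler_nat ltnW.
  apply: le_trans (Pr_setU_le _ mH2 mH3) _; apply: lerD.
    apply: le_trans (past_independence (mS k) (measurable_absgt GM mv k x) mB _) _.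
      move=> y /(sat_absgt GM K0_ge0 v_lip K_def) h.
      by apply: le_lt_trans h; lra.
    by rewrite ler_wpM2l// ler_wpM2r ?Pr_ge0// hp// ltnW.
  rewrite (Pr_iter_preimage GM k mH3').
  apply: le_trans (past_independence mB (mvgt ((1 + gamma) * N - K)) (mS _) _) _.
    by move=> y [z Bz yz]; exact: (@jump_same 1 0 y z).
  rewrite ler_wpM2l// ler_wpM2l ?Pr_ge0//.
  apply: le_trans (hp (n - k.+1)%N (leq_subr _ _)).
  by apply: (le_absgt GM mv); lra.
have -> : n%:R * Pr B = \sum_(k < n) Pr (F k).
  under eq_bigr do rewrite Pr_itergt.
  by rewrite sumr_const card_ord mulr_natl.
set b' := Pr [set y | _ - K < _] in key BKN.
apply: (@le_trans _ _ (\sum_(k < n) (Pr (G k) + (2 * C0 * p * Pr B + C0 * p * b')))).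
  apply: ler_sum => k _; apply: le_trans (key k (ltn_ord k)) _.
  by rewrite le_eqVlt; apply/orP; left; apply/eqP; ring.
rewrite big_split/= lerD// sumr_const card_ord -[leLHS]mulr_natl.
have := ler_wpM2l (mulr_ge0 C0_ge0 p0) BN.
have := ler_wpM2l (mulr_ge0 C0_ge0 p0) BKN.
rewrite expr2; set nr := n%:R; set b := Pr B.
have -> : nr * (2 * C0 * p * b + C0 * p * b') =
    2 * (C0 * p * (nr * b)) + C0 * p * (nr * b') by ring.
lra.
Qed.

End SingleJump.

(** * Tightness from convergence in distribution *)

Lemma exists_nonatom {R : realType} (G : probability R R) (x : R) :
  exists2 z : R, x <= z <= x + 1 & G [set z] = 0%E.
Proof.
pose X : {RV G >-> R} := mfun_Sub (mem_set (@measurable_id _ R setT)).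
(* A probability has countably many atoms, while an interval of length 1 has positive Lebesgue
   measure. *)
have cX := pmf_gt0_countable X.
apply: contrapT => /forall2NP H.
have : countable `[x, x + 1]%classic.
  apply: sub_countable cX; apply: subset_card_le => z.
  rewrite /= in_itv/= => xz; have [//|Gz] := H z.
  rewrite lt_def pmf_ge0 andbT /pmf; apply/eqP => G0; apply: Gz.
  by rewrite (PrE G (measurable_set1 z)) [Pr _ _]G0.
move/countable_lebesgue_measure0 => /eqP.
by rewrite lebesgue_measure_itv/= lte_fin ltrDl ltr01 -EFinD addrAC subrr add0r onee_eq0.
Qed.

(** Convergence is tested only at points that [G] does not charge, so the truncation levels are
    moved to such points. Two tails of [G] and two convergence errors, [eta / 4] each, add up to
    [eta]. *)
Lemma conv_in_distribution_tight {R : realType} {d : measure_display}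
    {Omega : measurableType d} (mu : probability Omega R)
    (X : nat -> Omega -> R) (G : probability R R) (eta : R) :
  (forall n, measurable_fun setT (X n)) -> conv_in_distribution mu X G ->
  0 < eta ->
  exists M : R, \forall n \near \oo, Pr mu [set y | M < `|X n y|] <= eta.
Proof.
move=> mX cX eta0.
have e4 : 0 < eta / 4 by rewrite divr_gt0.
have [x0 x00 Hx0] := exists_tail_le G (@measurable_id _ R setT) e4.
have [z1 /andP[z1l _] Gz1] := exists_nonatom G x0.
(* Starting at [- x0 - 2] gives [z2 <= - x0 - 1], strictly below [- x0], as the strict tail event
   requires. *)
have [z2 /andP[z2l z2r] Gz2] := exists_nonatom G (- x0 - 2).
have mle z : measurable [set w : R | w <= z].
  by rewrite (_ : [set w | _] = `]-oo, z]%classic).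
have mgt z : measurable [set w : R | z < w].
  rewrite (_ : [set w | _] = `]z, +oo[%classic)//.
  by apply/seteqP; split => w /=; rewrite in_itv/= andbT.
have mXle n z : measurable [set y | X n y <= z].
  by rewrite -[X in measurable X]setTI; exact: (mX n measurableT [set w | w <= z]).
have mXgt n z : measurable [set y | z < X n y] by exact: measurable_gt.
have compl (d' : measure_display) (T' : measurableType d') (nu : probability T' R)
    (f : T' -> R) z : measurable [set y | f y <= z] ->
    Pr nu [set y | z < f y] = 1 - Pr nu [set y | f y <= z].
  move=> mf; rewrite (_ : [set y | z < f y] = ~` [set y | f y <= z]).
    apply: EFin_inj; rewrite EFinB -!PrE//; last exact: measurableC.
    by rewrite probability_setC.
  by apply/seteqP; split => y /=; rewrite ltNge => /negP.
have G1 : Pr G [set w | z1 < w] <= eta / 4.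
  apply: le_trans (Hx0 z1 z1l); apply: le_Pr => //.
    by apply: measurable_gt; apply: measurableT_comp => //; exact: normr_measurable.
  by move=> w /= h; exact: lt_le_trans (ler_norm _).
have G2 : Pr G [set w | w <= z2] <= eta / 4.
  apply: le_trans (Hx0 x0 (lexx _)); apply: le_Pr => //.
    by apply: measurable_gt; apply: measurableT_comp => //; exact: normr_measurable.
  move=> w /= h; rewrite -normrN; apply: lt_le_trans (ler_norm _); lra.
exists (Num.max z1 (- z2)).
have /cvgrPdist_le/(_ _ e4) c1 := cX z1 Gz1.
have /cvgrPdist_le/(_ _ e4) c2 := cX z2 Gz2.
near=> n.
have : `|Pr G [set z | z <= z1] - Pr mu [set y | X n y <= z1]| <= eta / 4.
  by near: n.
have : `|Pr G [set z | z <= z2] - Pr mu [set y | X n y <= z2]| <= eta / 4.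
  by near: n.
rewrite !ler_norml => /andP[h1 _] /andP[_ h2].
apply: (@le_trans _ _ (Pr mu ([set y | z1 < X n y] `|` [set y | X n y <= z2]))).
  apply: le_Pr; [|exact: measurableU|].
    by apply: measurable_gt; apply: measurableT_comp => //; exact: normr_measurable.
  move=> y /= h.
  have [h'|h'] := ltP z1 (X n y); [by left|right].
  rewrite leNgt; apply/negP => h3.
  have : `|X n y| <= Num.max z1 (- z2).
    rewrite ler_norml; apply/andP; split; last by rewrite le_max h'.
    by rewrite lerNl le_max lerN2 (ltW h3) orbT.
  by rewrite leNgt h.
apply: le_trans (Pr_setU_le _ (mXgt n z1) (mXle n z2)) _.
rewrite (compl _ _ mu (X n))//.
have := compl _ _ G id z1 (mle z1) => cG.
move: G1; rewrite cG; lra.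
Unshelve. all: by end_near. Qed.

(** * Regular variation of the tails *)

Section RegularVariation.
Context {R : realType}.
Variables (ell : R -> R) (alpha : R).
Hypothesis sv : slowly_varying ell.

Definition regvar (x : R) : R := ell x * x `^ (- alpha).

Local Notation L := regvar.

Lemma near_regvar_gt0 : \forall x \near +oo, 0 < L x.
Proof.
have [_ [pos _]] := sv; near=> x; rewrite mulr_gt0//; first by near: x.
by rewrite powR_gt0//; near: x; exact: nbhs_pinfty_gt.
Unshelve. all: by end_near. Qed.

Lemma cvg_scale (lam : R) : 0 < lam -> lam * x @[x --> +oo] --> +oo.
Proof. by move=> l0; apply: gt0_cvgMry => //; exact: cvg_id. Qed.

Lemma regvar_scale (lam : R) : 0 < lam ->
  L (lam * x) / L x @[x --> +oo] --> lam `^ (- alpha).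
Proof.
move=> l0; have [_ [pos /(_ _ l0) svl]] := sv.
rewrite -[X in _ --> X]mul1r.
apply: cvg_trans (cvgM svl (cvg_cst (lam `^ (- alpha)))).
apply: near_eq_cvg; near=> x => /=.
have x0 : 0 < x by near: x; exact: nbhs_pinfty_gt.
have e0 : 0 < ell x by near: x.
rewrite /L powRM ?(ltW x0) ?(ltW l0)//.
have p0 : x `^ (- alpha) != 0 by rewrite gt_eqF// powR_gt0.
by field; rewrite p0 gt_eqF.
Unshelve. all: by end_near. Qed.

Lemma equiv_scale (u : R -> R) (c lam : R) : 0 < lam ->
  u x / L x @[x --> +oo] --> c ->
  u (lam * x) / L x @[x --> +oo] --> c * lam `^ (- alpha).
Proof.
move=> l0 uL.
have ul : u (lam * x) / L (lam * x) @[x --> +oo] --> c.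
  by apply: (cvg_comp _ (fun x => u x / L x) (cvg_scale l0)).
apply: cvg_trans (cvgM ul (regvar_scale l0)).
have nl : \forall x \near +oo, 0 < L (lam * x).
  exact: (cvg_scale l0 near_regvar_gt0).
apply: near_eq_cvg; near=> x => /=.
have h : 0 < L (lam * x) by near: x.
by rewrite mulrA divfK// gt_eqF.
Unshelve. all: by end_near. Qed.

Lemma powR_near1 (e : R) : 0 < e -> exists2 g : R, 0 < g < 1 &
  `|(1 - g) `^ (- alpha) - 1| <= e /\ `|(1 + g) `^ (- alpha) - 1| <= e.
Proof.
move=> e0.
have c : lam `^ (- alpha) @[lam --> (1 : R)] --> (1 : R).
  have d1 : derivable (fun w : R => w `^ (- alpha)) 1 1.
    by apply: derivable_powR; rewrite in_itv/= ltr01.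
  have c1 := differentiable_continuous (proj1 (derivable1_diffP _ _) d1).
  have p1 : 1 `^ (- alpha) = 1 :> R by rewrite powR1.
  by rewrite -[X in _ --> X]p1.
move/cvgrPdist_le : c => /(_ _ e0)[g /= g0 H].
exists (Num.min (g / 2) (1 / 2)).
  by rewrite lt_min gt_min !divr_gt0//=; apply/orP; right; lra.
have m0 : 0 < Num.min (g / 2) (1 / 2) by rewrite lt_min !divr_gt0.
have mg : Num.min (g / 2) (1 / 2) < g by rewrite gt_min; apply/orP; left; lra.
split; rewrite distrC; apply: H => /=.
  by rewrite opprB addrC subrK gtr0_norm.
by rewrite opprD addrA subrr sub0r normrN gtr0_norm.
Qed.

(* Continuity at 1 of the limit lam^-alpha makes the tail insensitive to small
   relative changes of the level. *)
Lemma tail_insensitive (u : R -> R) (c e : R) : 0 < e -> 0 <= c <= 1 ->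
  u x / L x @[x --> +oo] --> c ->
  exists2 g : R, 0 < g < 1 & \forall x \near +oo,
    `|u ((1 - g) * x) - u x| <= e * L x /\ `|u ((1 + g) * x) - u x| <= e * L x.
Proof.
move=> e0 /andP[c0 c1] uL; have e3 : 0 < e / 3 by rewrite divr_gt0.
have [g /andP[g0 g1] [gm gp]] := powR_near1 e3.
exists g; first by rewrite g0.
have key (lam : R) : 0 < lam -> `|lam `^ (- alpha) - 1| <= e / 3 ->
    \forall x \near +oo, `|u (lam * x) - u x| <= e * L x.
  move=> l0 hl.
  have /cvgrPdist_le/(_ _ e3) h1 := equiv_scale l0 uL.
  move/cvgrPdist_le : (uL) => /(_ _ e3) h2.
  near=> x.
  have L0 : 0 < L x by near: x; exact: near_regvar_gt0.
  have : `|c * lam `^ (- alpha) - u (lam * x) / L x| <= e / 3 by near: x.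
  have : `|c - u x / L x| <= e / 3 by near: x.
  have uE (w : R) : w = w / L x * L x by rewrite divfK// gt_eqF.
  rewrite (uE (u (lam * x))) (uE (u x)) !mulfK ?gt_eqF//.
  rewrite -mulrBl normrM (gtr0_norm L0) ler_pM2r//.
  set p1 := u x / L x; set p2 := u (lam * x) / L x.
  have : `|c * (lam `^ (- alpha) - 1)| <= e / 3.
    rewrite normrM (ger0_norm c0); apply: le_trans hl.
    by rewrite ler_piMl.
  set s := lam `^ (- alpha).
  rewrite !ler_norml => /andP[h3 h4] /andP[h5 h6] /andP[h7 h8].
  apply/andP; split; lra.
have g1' : 0 < 1 - g by rewrite subr_gt0.
have g2' : 0 < 1 + g by rewrite addr_gt0.
near=> x; split; near: x; exact: key.
Unshelve. all: by end_near. Qed.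

End RegularVariation.

(** * Single-jump asymptotics *)

Section SingleJumpAsymptotic.
Context {R : realType} {d : measure_display} {Omega : measurableType d}.
Context {J : countType} {mu : probability Omega R} {T : Omega -> Omega}.
Context {P : J -> set Omega} {theta : R}.
Hypothesis GM : GibbsMarkov mu T P theta.
Context {ell : R -> R} {alpha : R}.
Hypothesis sv : slowly_varying ell.
Context {N : nat -> R}.
Hypothesis N_infty : N n @[n --> \oo] --> +oo.

Local Notation Pr := (Pr mu).
Local Notation L := (regvar ell alpha).

Hypothesis nL_cvg0 : n%:R * L (N n) @[n --> \oo] --> (0 : R).

(** The order of choices matters: [eps] fixes the relative margin [g], and [g] fixes the constant
    [A] at level [g N / 12]. Only then does [n L(N) -> 0] make the square small. One half of [eps]
    pays for the shift of the level, the other for the square. *)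
Lemma single_jump_asymptotic (v : Omega -> R) (c : R) :
  measurable_fun setT v ->
  (exists K : R, forall j, Dj_le P T theta v j K) ->
  0 <= c <= 1 ->
  Pr [set y | x < v y] / L x @[x --> +oo] --> c ->
  (\forall x \near +oo, Pr [set y | x < `|v y|] <= 2 * L x) ->
  (forall c : R, 0 < c -> c <= 1 -> exists2 A : R, 0 <= A &
    \forall n \near \oo, forall m, (m <= n)%N ->
    Pr (absgt T v m (c * N n)) <= A * (n%:R * L (N n))) ->
  forall eps : R, 0 < eps -> \forall n \near \oo,
    `|Pr [set y | N n < birkhoff T v n y] - n%:R * Pr [set y | N n < v y]|
      <= eps * (n%:R * L (N n)).
Proof.
move=> mv [K1 v_lip1] c01 tail tail2 LD eps eps0.
have [C0 C01 QI] := quasi_independence GM.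
pose K0 : R := `|K1|.
have K00 : 0 <= K0 by exact: normr_ge0.
have v_lip0 j : Dj_le P T theta v j K0.
  move=> y y' yj yj' yy'; apply: le_trans (v_lip1 j _ _ yj yj' yy') _.
  by rewrite ler_wpM2r ?ler_norm// (dtheta_ge0 GM).
pose K := K0 / (1 - theta).
have up := jump_upper GM mv K00 v_lip0 C01 QI (erefl K).
have lo := jump_lower GM mv K00 v_lip0 C01 QI (erefl K).
have e2 : 0 < eps / 2 by rewrite divr_gt0.
have [g g01 ins] := tail_insensitive sv e2 c01 tail.
have /andP[g0 g1] := g01.
have [||A A0 HA] := LD (g / 12).
- by rewrite divr_gt0.
- by rewrite ler_pdivrMr// mul1r (le_trans (ltW g1))// ler1n.
(* With [A + 2] the single bound [A' * s] dominates both the large deviation probability and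
   [n P(|v| > N) <= 2 s]. *)
pose A' := A + 2.
have A'0 : 0 < A' by rewrite ltr_wpDl.
have AA' : A <= A' by rewrite lerDl.
have A2' : 2 <= A' by rewrite lerDr.
clearbody A'.
have C00 : 0 < C0 by exact: lt_le_trans C01.
pose C := C0 * (1 + C0) + 3 * C0.
have CC1 : C0 * (1 + C0) <= C by rewrite lerDl mulr_ge0// ltW.
have CC2 : 3 * C0 <= C by rewrite lerDr mulr_ge0// ?addr_ge0// ltW.
have C_gt0 : 0 < C by apply: lt_le_trans CC2; rewrite mulr_gt0.
clearbody C.
have D0 : 0 < eps / 2 / (C * A' ^+ 2) by rewrite divr_gt0// mulr_gt0// exprn_gt0.
have nbN (Q : R -> Prop) : (\forall x \near +oo, Q x) -> \forall n \near \oo, Q (N n).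
  by move=> h; exact: (N_infty h).
have nL := nbN (fun x => 0 < L x) (near_regvar_gt0 _ sv).
have nK := nbN (fun x => g^-1 * (6 * K) <= x) (nbhs_pinfty_ge (num_real _)).
have n2 := nbN (fun x => Pr [set y | x < `|v y|] <= 2 * L x) tail2.
have nins := nbN (fun x => `|Pr [set y | (1 - g) * x < v y] - Pr [set y | x < v y]|
    <= eps / 2 * L x /\
  `|Pr [set y | (1 + g) * x < v y] - Pr [set y | x < v y]| <= eps / 2 * L x) ins.
near=> n.
have L0 : 0 < L (N n) by near: n.
have KN : 6 * K <= g * N n by rewrite -ler_pdivrMl//; near: n.
have HAn : forall m, (m <= n)%N ->
    Pr (absgt T v m (g / 12 * N n)) <= A * (n%:R * L (N n)) by near: n.
have H2 : Pr [set y | N n < `|v y|] <= 2 * L (N n) by near: n.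
have [i1 i2] : `|Pr [set y | (1 - g) * N n < v y] - Pr [set y | N n < v y]|
      <= eps / 2 * L (N n) /\
    `|Pr [set y | (1 + g) * N n < v y] - Pr [set y | N n < v y]| <= eps / 2 * L (N n).
  by near: n.
have sm : n%:R * L (N n) <= eps / 2 / (C * A' ^+ 2).
  by near: n; exact: (cvgr_le _ nL_cvg0).
set s := n%:R * L (N n) in HAn sm *.
have s0 : 0 <= s by rewrite mulr_ge0// ltW.
have hp m : (m <= n)%N -> Pr (absgt T v m (g * N n / 12)) <= A' * s.
  move=> mn; rewrite mulrAC; apply: le_trans (HAn m mn) _.
  by rewrite ler_wpM2r.
have hv : n%:R * Pr [set y | N n < `|v y|] <= A' * s.
  apply: le_trans (ler_wpM2l (ler0n _ n) H2) _.
  by rewrite mulrCA -/s ler_wpM2r.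
have quad : C * (A' * s) ^+ 2 <= eps / 2 * s.
  rewrite exprMn mulrA [s ^+ 2]expr2 mulrA ler_wpM2r// mulrC.
  by rewrite -ler_pdivlMr// mulr_gt0// exprn_gt0.
have quad' (c' : R) : c' <= C -> c' * (A' * s) ^+ 2 <= eps / 2 * s.
  by move=> cC; apply: le_trans quad; rewrite ler_wpM2r// sqr_ge0.
have u1 := up n (N n) g (A' * s) g01 KN hp.
have u2 := lo n (N n) g (A' * s) g0 KN hp hv.
have q1 := quad' _ CC1; have q2 := quad' _ CC2.
have scale (w : R) : w <= eps / 2 * L (N n) -> n%:R * w <= eps / 2 * s.
  by move=> h; rewrite mulrCA ler_wpM2l.
move: i1 i2; rewrite !ler_norml => /andP[_ /scale i1] /andP[i2 _].
have {}i2 : n%:R * (Pr [set y | N n < v y] - Pr [set y | (1 + g) * N n < v y])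
    <= eps / 2 * s.
  by apply: scale; rewrite -lerN2 opprB.
move: i1 i2; rewrite !mulrBr => i1 i2.
move: u1 u2 i1 i2 q1 q2; set w0 := Pr [set y | N n < birkhoff _ _ _ _].
set w1 := n%:R * Pr [set y | N n < v y].
set w2 := n%:R * _; set w3 := n%:R * _.
set Q1 := C0 * (1 + C0) * _; set Q2 := 3 * C0 * _.
move=> u1 u2 i1 i2 q1 q2; apply/andP; split; lra.
Unshelve. all: by end_near. Qed.

End SingleJumpAsymptotic.

Lemma near_pinfty_ge {R : realType} (Q : R -> Prop) :
  (\forall x \near +oo, Q x) -> exists2 X : R, 1 <= X & forall x, X <= x -> Q x.
Proof.
move=> [X [_ HX]]; exists (Num.max 1 (X + 1)); first by rewrite le_max lexx.
by move=> x; rewrite ge_max => /andP[_ h]; apply: HX; rewrite (lt_le_trans _ h)// ltrDl.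
Qed.

(** * Growth of [ellhat] for [alpha = 2] *)

Section TruncatedVariance.
Context {R : realType} {ell t : R -> R}.
Hypothesis sv : slowly_varying ell.
Hypothesis ell_int : forall x : R, 1 <= x ->
  (@lebesgue_measure R).-integrable `[1, x]%classic (fun u => (ell u / u)%:E).
Hypothesis t_ge0 : forall x, 0 <= t x.
Hypothesis t_mono : forall x y, x <= y -> t y <= t x.
Hypothesis t_equiv : t x / regvar ell 2 x @[x --> +oo] --> (1 : R).

Local Notation w := (fun u : R => ell u / u).
Local Notation H := (ellhat ell).
(** A stand-in for [ell], to which it is asymptotic. Slow variation gives limits for one ratio at a
    time, whereas [t] is monotone, so [e] is controlled on a whole interval by its endpoints. *)
Let e (x : R) := t x * x ^+ 2.

Lemma regvar2E x : 0 < x -> regvar ell 2 x = ell x / x ^+ 2.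
Proof. by move=> x0; rewrite /regvar powR_invn// ltW. Qed.

Lemma near_ell_tail : \forall x \near +oo,
  [/\ 0 < ell x, ell x <= 2 * e x & e x <= 2 * ell x].
Proof.
have [_ [pos _]] := sv.
have h : 2^-1 < 1 :> R by rewrite invf_lt1// ltr1n.
have h2 : 1 < 2 :> R by rewrite ltr1n.
have H1 : \forall x \near +oo, 2^-1 <= t x / regvar ell 2 x.
  exact: cvgr_ge t_equiv _ h.
have H2 : \forall x \near +oo, t x / regvar ell 2 x <= 2.
  exact: cvgr_le t_equiv _ h2.
near=> x.
have x0 : 0 < x by near: x; exact: nbhs_pinfty_gt.
have l0 : 0 < ell x by near: x.
have : 2^-1 <= t x / regvar ell 2 x by near: x.
have : t x / regvar ell 2 x <= 2 by near: x.
rewrite regvar2E// invf_div mulrA -/(e x) ler_pdivrMr// ler_pdivlMr// => h3 h4.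
by split => //; lra.
Unshelve. all: by end_near. Qed.

Lemma cvg_tail_scale (lam : R) : 0 < lam ->
  t (lam * x) / t x @[x --> +oo] --> (lam ^+ 2)^-1.
Proof.
move=> l0.
have c1 := equiv_scale sv l0 t_equiv.
have -> : (lam ^+ 2)^-1 = 1 * lam `^ (- 2) * 1^-1.
  by rewrite invr1 mulr1 mul1r powR_invn// ltW.
apply: cvg_trans (cvgM c1 (cvgV (oner_neq0 R) t_equiv)).
apply: near_eq_cvg; have pos := near_regvar_gt0 2 sv.
near=> x => /=.
have L0 : 0 < regvar ell 2 x by near: x.
by rewrite invf_div mulrA divfK// gt_eqF.
Unshelve. all: by end_near. Qed.

Lemma ellhatB (x y : R) : 0 <= x -> x <= y ->
  H y - H x = \int[lebesgue_measure]_(u in `]1 + x, 1 + y]) w u.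
Proof.
move=> x0 xy.
rewrite -(@Rintegral_itvB _ _ (BLeft 1)) ?bnd_simp.
- by rewrite /ellhat opprD addrACA subrr add0r.
- by apply: ell_int; rewrite lerDl (le_trans x0).
- by rewrite lerDl.
- by rewrite lerD2l.
Qed.

Lemma ellhat_incr_bounds (a b x y : R) : 0 <= x -> x <= y ->
  (forall u, 1 + x < u -> u <= 1 + y -> a <= w u <= b) ->
  a * (y - x) <= H y - H x <= b * (y - x).
Proof.
move=> x0 xy ab; rewrite ellhatB//.
set D := `]1 + x, 1 + y]%classic.
have mD : measurable D by exact: measurable_itv.
have muD : lebesgue_measure D = (y - x)%:E.
  rewrite lebesgue_measure_itv/= lte_fin ltrD2l.
  case: ltP => [_|yx]; first by rewrite -EFinB; congr EFin; lra.
  have -> : y = x by apply/eqP; rewrite eq_le xy yx.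
  by rewrite subrr.
have fD : (lebesgue_measure D < +oo)%E by rewrite muD ltry.
have ic (c : R) : lebesgue_measure.-integrable D (EFin \o cst c).
  apply: measurable_bounded_integrable => //; exact: bounded_cst.
have iw : lebesgue_measure.-integrable D (EFin \o w).
  apply: (integrableS _ _ _ (ell_int (_ : 1 <= 1 + y))) => //.
  - move=> u; rewrite /D /= !in_itv/= => /andP[h1 h2]; rewrite h2 andbT.
    by apply: le_trans (ltW h1); rewrite lerDl.
  - by rewrite lerDl (le_trans x0).
have cstE (c : R) : \int[lebesgue_measure]_(u in D) cst c u = c * (y - x).
  by rewrite Rintegral_cst//; congr (_ * _); exact: (congr1 fine muD).
rewrite -!cstE; apply/andP; split; apply: le_Rintegral => // u.
  by rewrite /D /= in_itv/= => /andP[h1 h2]; have /andP[] := ab u h1 h2.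
by rewrite /D /= in_itv/= => /andP[h1 h2]; have /andP[] := ab u h1 h2.
Qed.

Hypothesis H_pos : forall X : R, exists2 x, X <= x & 0 < H x.

Lemma near_ellhat_incr : \forall x \near +oo,
  [/\ 0 < H x, (forall y, x <= y -> H x <= H y),
      36^-1 * e x <= H (5 * x) - H x & H (5 * x) - H x <= 48 * e x].
Proof.
have [X1 X11 HX1] := near_pinfty_ge near_ell_tail.
have l6 : 0 < 6 :> R by [].
have h72 : 72^-1 < (6 ^+ 2)^-1 :> R by lra.
have [X2 X21 HX2] := near_pinfty_ge (cvgr_ge _ (cvg_tail_scale l6) _ h72).
have [x1 x1X Hx1] := H_pos X1.
have Hmono x y : X1 <= x -> x <= y -> H x <= H y.
  move=> xX xy; rewrite -subr_ge0; rewrite ellhatB//; last lra.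
  apply: Rintegral_ge0 => u; rewrite /= in_itv/= => /andP[h1 h2].
  have [l0 _ _] := HX1 u ltac:(lra).
  by rewrite divr_ge0 ?(ltW l0)//; lra.
near=> x.
have x0 : 0 < x by near: x; exact: nbhs_pinfty_gt.
have xX1 : X1 <= x by near: x; exact/nbhs_pinfty_ge/num_real.
have xX2 : X2 <= x by near: x; exact/nbhs_pinfty_ge/num_real.
have xx1 : x1 <= x by near: x; exact/nbhs_pinfty_ge/num_real.
have x5 : x <= 5 * x by lra.
(* The integral runs over []1 + x, 1 + 5x]], of length [4x] and inside [[x, 6x]]. There [ell u / u]
   is at most [12 x t(x)] and at least [x t(6x) / 2], with [t(6x) >= t(x) / 72]; hence 48 and
   1/36. *)
have := @ellhat_incr_bounds (t (6 * x) * x / 2) (2 * t x * (6 * x)) x (5 * x)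
  (ltW x0) x5.
move=> /(_ _)/andP[|].
  move=> u h1 h2.
  have uX : X1 <= u by lra.
  have u0 : 0 < u by lra.
  have [l0 la lb] := HX1 u uX.
  have tu : t u <= t x by apply: t_mono; lra.
  have tu6 : t (6 * x) <= t u by apply: t_mono; lra.
  have eE : e u = t u * u * u by rewrite /e expr2 mulrA.
  apply/andP; split.
    rewrite ler_pdivlMr//; move: lb; rewrite eE.
    have : t (6 * x) * x <= t u * u by rewrite ler_pM//; lra.
    move=> h lb.
    have : t (6 * x) * x * u <= t u * u * u by rewrite ler_wpM2r// ltW.
    lra.
  rewrite ler_pdivrMr//; apply: le_trans la _; rewrite eE.
  have : t u * u <= t x * (6 * x) by rewrite ler_pM//; lra.
  move=> h; have : t u * u * u <= t x * (6 * x) * u by rewrite ler_wpM2r// ltW.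
  lra.
move=> lo up; split => //.
- by apply: lt_le_trans Hx1 _; exact: Hmono.
- by move=> y; exact: Hmono.
- apply: le_trans lo; have := HX2 x xX2.
  have [t0|tn0] := eqVneq (t x) 0.
    by rewrite /e t0 mul0r mulr0 mulr_ge0 ?mulr_ge0 ?subr_ge0// ltW.
  have tp : 0 < t x by rewrite lt_def tn0 t_ge0.
  rewrite ler_pdivlMr// => h.
  have : 0 <= x * x by rewrite mulr_ge0 ?ltW.
  move=> xx; have := ler_wpM2r xx h; rewrite /e expr2; lra.
- by apply: le_trans up _; rewrite /e expr2; lra.
Unshelve. all: by end_near. Qed.

(* e is slowly varying, so each step of a factor 5 adds about the same amount
   to H; hence e = o(H), and H itself is slowly varying. *)
Lemma near_ellhat_dominates (m : nat) :
  \forall x \near +oo, m%:R / 72 * e x <= H x.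
Proof.
have [X1 X11 HX1] := near_pinfty_ge near_ellhat_incr.
elim: m => [|m IH].
  near=> x; rewrite mul0r mul0r.
  have [h _ _ _] : [/\ 0 < H x, (forall y, x <= y -> H x <= H y),
      36^-1 * e x <= H (5 * x) - H x & H (5 * x) - H x <= 48 * e x].
    by near: x; exact: near_ellhat_incr.
  exact: ltW.
have l5 : 0 < 5 :> R by [].
have l5' : 0 < 5^-1 :> R by [].
have m1 : 0 < m.+1%:R :> R by [].
(* The increment [e(x) / 36] raises [m] to [m + 2] in units of 1/72. One unit is given back, because
   [e(5x) / e(x)] tends to 1 and is eventually at most [(m + 2) / (m + 1)]. *)
have hk : (5 ^+ 2)^-1 < (m.+2%:R / m.+1%:R) / 25 :> R.
  have : 1 < m.+2%:R / m.+1%:R :> R by rewrite ltr_pdivlMr// mul1r ltr_nat.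
  set k := _ / _ => k1; lra.
have H5 : \forall x \near +oo, m.+1%:R / 72 * e (5 * x) <= H (5 * x).
  have nt : \forall x \near +oo, t (5 * x) / t x <= m.+2%:R / m.+1%:R / 25.
    exact: cvgr_le (cvg_tail_scale l5) _ hk.
  near=> x.
  have [h0 h1 h2 h3] : [/\ 0 < H x, (forall y, x <= y -> H x <= H y),
      36^-1 * e x <= H (5 * x) - H x & H (5 * x) - H x <= 48 * e x].
    by near: x; exact: near_ellhat_incr.
  have hm : m%:R / 72 * e x <= H x by near: x.
  have x0 : 0 < x by near: x; exact: nbhs_pinfty_gt.
  have ht : t (5 * x) / t x <= m.+2%:R / m.+1%:R / 25 by near: x.
  have he : m.+1%:R * e (5 * x) <= m.+2%:R * e x.
    have [t0|tn0] := eqVneq (t x) 0.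
      have t50 : t (5 * x) = 0.
        by apply/eqP; rewrite eq_le t_ge0 andbT -t0 t_mono//; lra.
      by rewrite /e t0 t50 !mul0r !mulr0.
    have tp : 0 < t x by rewrite lt_def tn0 t_ge0.
    move: ht; rewrite ler_pdivrMr// => ht.
    have xx : 0 <= 25 * (x * x) * m.+1%:R by rewrite !mulr_ge0// ltW.
    have := ler_wpM2r xx ht.
    have -> : m.+2%:R / m.+1%:R / 25 * t x * (25 * (x * x) * m.+1%:R) =
       m.+2%:R * (t x * (x * x)) :> R by field; rewrite gt_eqF.
    by rewrite /e !expr2; lra.
  have e1 : m.+1%:R = m%:R + 1 :> R by rewrite -natr1.
  have e2 : m.+2%:R = m%:R + 2 :> R by rewrite -addn2 natrD.
  move: he hm h2; rewrite e1 e2.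
  by move: (m%:R) (e x) (e (5 * x)) => p E E5; lra.
near=> x.
have -> : x = 5 * (5^-1 * x) by rewrite mulrA divff// mul1r.
near: x.
exact: (cvg_scale l5' H5).
Unshelve. all: by end_near. Qed.

Lemma ellhat_comparator : exists2 X0 : R, 1 <= X0 & forall x, X0 <= x ->
  [/\ 0 < H x / x ^+ 2, t x <= H x / x ^+ 2,
      (forall y, x <= y -> y <= 5 * x -> H y / y ^+ 2 <= 25 * (H x / x ^+ 2)),
      (forall y, x <= y -> y <= 5 * x -> H x / x ^+ 2 <= 25 * (H y / y ^+ 2)) &
      H (5 * x) / (5 * x) ^+ 2 <= 5^-1 * (H x / x ^+ 2)].
Proof.
have [X1 X11 HX1] := near_pinfty_ge near_ellhat_incr.
(* As [864 / 72 = 12], the increment, at most [48 e], is at most [4 H]; thus [H(5x) <= 5 H(x)], and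
   division by 25 leaves the rate 1/5. *)
have [X2 X21 HX2] := near_pinfty_ge (near_ellhat_dominates 864).
exists (Num.max X1 X2); first by rewrite le_max X11.
move=> x; rewrite ge_max => /andP[xX1 xX2].
have x0 : 0 < x by lra.
have [Hx Hm _ Hu] := HX1 x xX1.
have He := HX2 x xX2.
have e0 : 0 <= e x by rewrite mulr_ge0// sqr_ge0.
have H5 : H (5 * x) <= 5 * H x by lra.
have xx0 : 0 < x ^+ 2 by rewrite exprn_gt0.
have q0 : 0 < H x / x ^+ 2 by rewrite divr_gt0.
split => //.
- by rewrite ler_pdivlMr// -/(e x); lra.
- move=> y xy y5; have y0 : 0 < y by lra.
  have yy0 : 0 < y ^+ 2 by rewrite exprn_gt0.
  have [_ Hmy _ _] := HX1 y ltac:(lra).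
  have Hy : H y <= 5 * H x by apply: le_trans H5; exact: Hmy.
  rewrite ler_pdivrMr//; apply: le_trans Hy _.
  have -> : 25 * (H x / x ^+ 2) * y ^+ 2 = 25 * H x * (y ^+ 2 / x ^+ 2) by ring.
  have : 1 <= y ^+ 2 / x ^+ 2.
    by rewrite ler_pdivlMr// mul1r ler_sqr ?nnegrE// ltW.
  move=> h; have := ler_wpM2l (ltW Hx) h; lra.
- move=> y xy y5; have y0 : 0 < y by lra.
  have yy0 : 0 < y ^+ 2 by rewrite exprn_gt0.
  have Hy : H x <= H y by exact: Hm.
  have Hy0 : 0 <= H y by lra.
  rewrite ler_pdivrMr//; apply: le_trans Hy _.
  have -> : 25 * (H y / y ^+ 2) * x ^+ 2 = H y * (25 * x ^+ 2 / y ^+ 2) by ring.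
  have : 1 <= 25 * x ^+ 2 / y ^+ 2.
    rewrite ler_pdivlMr// mul1r.
    have : y ^+ 2 <= (5 * x) ^+ 2 by rewrite ler_sqr ?nnegrE//; lra.
    by rewrite !expr2; lra.
  move=> h; have := ler_wpM2l Hy0 h; lra.
- rewrite exprMn invfM.
  have -> : H (5 * x) * ((5 ^+ 2)^-1 * (x ^+ 2)^-1) = 25^-1 * (H (5 * x) / x ^+ 2).
    rewrite (_ : (5 ^+ 2 : R) = 25); first by ring.
    by rewrite expr2; ring.
  have : H (5 * x) / x ^+ 2 <= 5 * H x / x ^+ 2.
    by rewrite ler_pdivrMr// divfK// gt_eqF.
  by rewrite -mulrA; set a := H x / _; lra.
Qed.

End TruncatedVariance.

Lemma birkhoffN {R : realType} {Omega : Type} (T : Omega -> Omega)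
    (v : Omega -> R) n y : birkhoff T (fun z => - v z) n y = - birkhoff T v n y.
Proof. by rewrite /birkhoff sumrN. Qed.

(** * Large deviations under the tail hypotheses *)

Section LargeDeviations.
Context {R : realType} {d : measure_display} {Omega : measurableType d}.
Context {J : countType} {mu : probability Omega R} {T : Omega -> Omega}.
Context {P : J -> set Omega} {theta : R}.
Hypothesis GM : GibbsMarkov mu T P theta.
Context {v : Omega -> R} {alpha p q : R} {ell : R -> R}.
Hypothesis mv : measurable_fun setT v.
Hypothesis v_lip : exists K : R, forall j, Dj_le P T theta v j K.
Hypothesis alpha_gt0 : 0 < alpha.
Hypothesis sv : slowly_varying ell.
Hypothesis p_gt0 : 0 < p.
Hypothesis q_gt0 : 0 < q.
Hypothesis pq1 : p + q = 1.

Local Notation Pr := (Pr mu).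
Local Notation S := (birkhoff T v).
Local Notation L := (regvar ell alpha).
Local Notation t := (fun x : R => Pr [set y | x < `|v y|]).

Hypothesis tail_p : Pr [set y | x < v y] / (p * ell x * x `^ (- alpha))
  @[x --> +oo] --> (1 : R).
Hypothesis tail_q : Pr [set y | v y < - x] / (q * ell x * x `^ (- alpha))
  @[x --> +oo] --> (1 : R).

Context {a : nat -> R}.
Hypothesis a_gt0 : forall n, 0 < a n.
Hypothesis a_infty : a n @[n --> \oo] --> +oo.
Hypothesis tight : forall eta : R, 0 < eta ->
  exists M : R, \forall n \near \oo, Pr (absgt T v n (M * a n)) <= eta.

Context {N : nat -> R}.
Hypothesis N_infty : N n @[n --> \oo] --> +oo.
Hypothesis N_far : N n / a n @[n --> \oo] --> +oo.

Let mNv : measurable_fun setT (fun y => - v y).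
Proof. by apply: measurableT_comp => //; exact: oppr_measurable. Qed.

Let mgt x : measurable [set y | x < v y].
Proof. exact: measurable_gt. Qed.

Let mlt x : measurable [set y | v y < - x].
Proof.
rewrite (_ : [set y | _] = [set y | x < - v y]); first exact: measurable_gt.
by apply/seteqP; split => y /=; rewrite ltrNr.
Qed.

Let mabs (x : R) : measurable [set y | x < `|v y|].
Proof.
apply: (@measurable_gt _ _ _ (fun y => `|v y|)).
by apply: measurableT_comp => //; exact: normr_measurable.
Qed.

Lemma equiv_const (u : R -> R) (c : R) : 0 < c ->
  u x / (c * ell x * x `^ (- alpha)) @[x --> +oo] --> (1 : R) ->
  u x / L x @[x --> +oo] --> c.
Proof.
move=> c0 h; rewrite -[X in _ --> X]mulr1.
apply: cvg_trans (cvgM (cvg_cst c) h).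
have pos := near_regvar_gt0 alpha sv.
apply: near_eq_cvg; near=> x => /=.
have : 0 < L x by near: x.
rewrite /regvar => L0.
rewrite -[c * _ * _]mulrA; move: L0; move: (ell x * _) => l l0.
by field; rewrite !gt_eqF.
Unshelve. all: by end_near. Qed.

Lemma tail_abs : t x / L x @[x --> +oo] --> (1 : R).
Proof.
rewrite -pq1.
apply: cvg_trans (cvgD (equiv_const p_gt0 tail_p) (equiv_const q_gt0 tail_q)).
apply: near_eq_cvg; near=> x => /=.
have x0 : 0 < x by near: x; exact: nbhs_pinfty_gt.
rewrite -mulrDl; congr (_ / _).
have -> : [set y | x < `|v y|] = [set y | x < v y] `|` [set y | v y < - x].
  apply/seteqP; split => y /=; rewrite real_lter_normr ?num_real// [x < - _]ltrNr.
    by move=> /orP[]; [left|right].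
  by move=> [->//|->]; rewrite orbT.
apply: EFin_inj; rewrite -PrE; last exact: measurableU.
rewrite measureU//; first by rewrite EFinD -!PrE.
apply/seteqP; split => // y /= [h1 h2].
have := lt_trans h1 h2; lra.
Unshelve. all: by end_near. Qed.

Lemma t_mono (x y : R) : x <= y -> t y <= t x.
Proof. by move=> xy; apply: le_Pr => // z /=; exact: le_lt_trans. Qed.

(** The ratio of the tail over a factor 5 tends to [s = 5^-alpha], strictly between 0 and 1; [2 / s]
    and the midpoint of [s] and 1 leave a margin on either side. *)
Lemma tail_comparator : exists X0 B rho : R, [/\ 0 < X0, 1 <= B, 0 < rho < 1 &
  forall x, X0 <= x -> [/\ 0 < t x, t x <= B * t (5 * x) & t (5 * x) <= rho * t x]].
Proof.
have l5 : 0 < 5 :> R by [].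
pose s : R := 5 `^ (- alpha).
have s0 : 0 < s by exact: powR_gt0.
have s1 : s < 1.
  rewrite /s powRN invf_lt1 ?powR_gt0//.
  have : 1 `^ alpha < 5 `^ alpha :> R.
    by apply: gt0_ltr_powR; rewrite ?nnegrE// ltr1n.
  by rewrite powR1.
have c5 : t (5 * x) / t x @[x --> +oo] --> s.
  have c1 := equiv_scale sv l5 tail_abs.
  have -> : s = 1 * s * 1^-1 by rewrite mul1r invr1 mulr1.
  apply: cvg_trans (cvgM c1 (cvgV (oner_neq0 R) tail_abs)).
  have pos := near_regvar_gt0 alpha sv.
  apply: near_eq_cvg; near=> x => /=.
  have L0 : 0 < L x by near: x.
  by rewrite invf_div mulrA divfK// gt_eqF.
have h1 : s / 2 < s by lra.
have h2 : s < (1 + s) / 2 by lra.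
have h3 : 2^-1 < 1 :> R by lra.
have n1 : \forall x \near +oo, s / 2 <= t (5 * x) / t x by exact: cvgr_ge c5 _ h1.
have n2 : \forall x \near +oo, t (5 * x) / t x <= (1 + s) / 2.
  exact: cvgr_le c5 _ h2.
have n3 : \forall x \near +oo, 2^-1 <= t x / L x by exact: cvgr_ge tail_abs _ h3.
have pos := near_regvar_gt0 alpha sv.
have [X X1 HX] : exists2 X : R, 1 <= X & forall x, X <= x ->
    [/\ 0 < t x, t x <= 2 / s * t (5 * x) & t (5 * x) <= (1 + s) / 2 * t x].
  apply: near_pinfty_ge; near=> x.
  have L0 : 0 < L x by near: x.
  have tp : 0 < t x.
    have : 2^-1 <= t x / L x by near: x.
    by rewrite ler_pdivlMr//; apply: lt_le_trans; rewrite mulr_gt0.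
  split => //.
    have : s / 2 <= t (5 * x) / t x by near: x.
    by rewrite ler_pdivlMr// mulrC -ler_pdivlMr ?divr_gt0// invf_div mulrC.
  have : t (5 * x) / t x <= (1 + s) / 2 by near: x.
  by rewrite ler_pdivrMr.
exists X, (2 / s), ((1 + s) / 2); split => //.
- exact: lt_le_trans X1.
- by rewrite ler_pdivlMr// mul1r; lra.
- by apply/andP; split; lra.
Unshelve. all: by end_near. Qed.

(** * Norming by [ell], for [alpha < 2] *)

Section StableCase.
Hypothesis norming : a n `^ alpha / (n%:R * ell (a n)) @[n --> \oo] --> (1 : R).

Lemma nL_a_cvg1 : n%:R * L (a n) @[n --> \oo] --> (1 : R).
Proof.
rewrite -[X in _ --> X]invr1.
apply: cvg_trans (cvgV (oner_neq0 R) norming).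
apply: near_eq_cvg; near=> n => /=.
by rewrite invf_div /regvar powRN mulrA.
Unshelve. all: by end_near. Qed.

Lemma nt_a_cvg1 : n%:R * t (a n) @[n --> \oo] --> (1 : R).
Proof.
have ta : t (a n) / L (a n) @[n --> \oo] --> (1 : R).
  exact: (cvg_comp _ (fun x => t x / L x) a_infty tail_abs).
rewrite -[X in _ --> X]mulr1.
apply: cvg_trans (cvgM nL_a_cvg1 ta).
have pos : \forall n \near \oo, 0 < L (a n).
  exact: (a_infty (near_regvar_gt0 alpha sv)).
apply: near_eq_cvg; near=> n => /=.
have L0 : 0 < L (a n) by near: n.
by field; rewrite gt_eqF.
Unshelve. all: by end_near. Qed.

(** The comparator is [t] rather than [L], since its monotonicity bounds it between [x] and [5x];
    the result is carried over by [t / L -> 1]. *)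
Lemma stable_bounds :
  n%:R * L (N n) @[n --> \oo] --> (0 : R) /\
  forall c : R, 0 < c -> c <= 1 -> exists2 A : R, 0 <= A &
    \forall n \near \oo, forall m, (m <= n)%N ->
    Pr (absgt T v m (c * N n)) <= A * (n%:R * L (N n)).
Proof.
have [X0 [B [rho [X00 B1 rho01 H]]]] := tail_comparator.
have t0 x : X0 <= x -> 0 < t x by move=> /H[].
have tv (x : R) : X0 <= x -> Pr [set y | x < `|v y|] <= 1 * t x by rewrite mul1r.
have tup (x y : R) : X0 <= x -> x <= y -> y <= 5 * x -> t y <= B * t x.
  move=> xX xy _; apply: le_trans (t_mono xy) _.
  by rewrite ler_peMl// ltW// t0.
have tdn (x y : R) : X0 <= x -> x <= y -> y <= 5 * x -> t x <= B * t y.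
  move=> xX xy y5; have [_ h _] := H x xX; apply: le_trans h _.
  by rewrite ler_wpM2l ?t_mono//; exact: le_trans B1.
have tdec (x : R) : X0 <= x -> t (5 * x) <= rho * t x by move=> /H[].
have z := nPhi_N_cvg0 X00 B1 rho01 t0 tup tdec a_gt0 a_infty nt_a_cvg1 N_far.
have tN : t (N n) / L (N n) @[n --> \oo] --> (1 : R).
  exact: (cvg_comp _ (fun x => t x / L x) N_infty tail_abs).
have pos : \forall n \near \oo, 0 < L (N n).
  exact: (N_infty (near_regvar_gt0 alpha sv)).
split.
  have -> : (0 : R) = 0 * 1^-1 by rewrite mul0r.
  apply: cvg_trans (cvgM z (cvgV (oner_neq0 R) tN)).
  have tpos : \forall n \near \oo, X0 <= N n.
    exact: (N_infty (nbhs_pinfty_ge (num_real X0))).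
  apply: near_eq_cvg; near=> n => /=.
  have tt : 0 < t (N n) by apply: t0; near: n.
  by rewrite invf_div mulrA -[n%:R * _ * _]mulrA [t _ * _]mulrC mulrA mulfK// gt_eqF.
move=> c c0 c1.
have [A A0 HA] := large_deviation_scaled GM mv v_lip X00 ler01 B1 rho01 t0 tv tup
  tdn tdec a_gt0 a_infty nt_a_cvg1 tight N_far c0 c1.
exists (A * 2); first by rewrite mulr_ge0.
have h2 : 1 < 2 :> R by rewrite ltr1n.
have n2 : \forall n \near \oo, t (N n) / L (N n) <= 2 by exact: cvgr_le tN _ h2.
near=> n => m mn.
have HAn : forall m, (m <= n)%N ->
    Pr (absgt T v m (c * N n)) <= A * (n%:R * t (N n)) by near: n.
apply: le_trans (HAn m mn) _; rewrite -mulrA ler_wpM2l// mulrCA ler_wpM2l//.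
have L0 : 0 < L (N n) by near: n.
by rewrite -ler_pdivrMr//; near: n.
Unshelve. all: by end_near. Qed.

Lemma large_deviation_stable_up (eps : R) : 0 < eps -> \forall n \near \oo,
  `|Pr [set y | N n < S n y] - n%:R * Pr [set y | N n < v y]|
    <= eps * (n%:R * L (N n)).
Proof.
have [z LD] := stable_bounds.
have p01 : 0 <= p <= 1 by rewrite -pq1 lerDl !ltW.
have h2 : 1 < 2 :> R by rewrite ltr1n.
apply: (single_jump_asymptotic GM sv N_infty z mv v_lip p01) => //.
  exact: equiv_const.
have n2 : \forall x \near +oo, t x / L x <= 2 by exact: cvgr_le tail_abs _ h2.
have pos := near_regvar_gt0 alpha sv.
near=> x; have L0 : 0 < L x by near: x.
by rewrite -ler_pdivrMr//; near: x.
Unshelve. all: by end_near. Qed.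

Lemma large_deviation_stable_down (eps : R) : 0 < eps -> \forall n \near \oo,
  `|Pr [set y | S n y < - N n] - n%:R * Pr [set y | v y < - N n]|
    <= eps * (n%:R * L (N n)).
Proof.
move=> eps0; have [z LD] := stable_bounds.
have q01 : 0 <= q <= 1 by rewrite -pq1 lerDr !ltW.
have h2 : 1 < 2 :> R by rewrite ltr1n.
have vN (x : R) : [set y | x < - v y] = [set y | v y < - x].
  by apply/seteqP; split => y /=; rewrite ltrNr.
have vabs (x : R) : [set y | x < `|- v y|] = [set y | x < `|v y|].
  by apply/seteqP; split => y /=; rewrite normrN.
have SN n x : [set y | x < birkhoff T (fun z => - v z) n y] =
    [set y | S n y < - x].
  by apply/seteqP; split => y /=; rewrite birkhoffN ltrNr.
have Sabs n x : absgt T (fun z => - v z) n x = absgt T v n x.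
  by apply/seteqP; split => y; rewrite /absgt/= birkhoffN normrN.
have : \forall n \near \oo,
    `|Pr [set y | N n < birkhoff T (fun z => - v z) n y] -
      n%:R * Pr [set y | N n < - v y]| <= eps * (n%:R * L (N n)).
  apply: (single_jump_asymptotic GM sv N_infty z mNv _ q01) => //.
  - have [K HK] := v_lip; exists K => j y y' yj yj' yy'.
    by rewrite -opprD normrN; exact: (HK j).
  - under eq_fun do rewrite vN.
    exact: equiv_const.
  - have n2 : \forall x \near +oo, t x / L x <= 2 by exact: cvgr_le tail_abs _ h2.
    have pos := near_regvar_gt0 alpha sv.
    near=> x; have L0 : 0 < L x by near: x.
    by rewrite vabs -ler_pdivrMr//; near: x.
  - move=> c c0 c1; have [A A0 HA] := LD c c0 c1; exists A => //.
    by apply: filterS HA => n HA m mn; rewrite Sabs; exact: HA.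
by apply: filterS => n; rewrite SN vN.
Unshelve. all: by end_near. Qed.

End StableCase.

(** * Norming by [ellhat], for [alpha = 2] *)

Section BoundaryCase.
Hypothesis alpha2 : alpha = 2.
Hypothesis ell_int : forall x : R, 1 <= x ->
  (@lebesgue_measure R).-integrable `[1, x]%classic (fun u => (ell u / u)%:E).
Hypothesis norming :
  a n ^+ 2 / (n%:R * ellhat ell (a n)) @[n --> \oo] --> (1 : R).

Local Notation Phi := (fun x : R => ellhat ell x / x ^+ 2).

(** Since [ell] is positive only near infinity, the integral in [ellhat] may start out negative;
    positivity is read off from the norming along [a n]. *)
Lemma ellhat_frequently_gt0 (X : R) : exists2 x, X <= x & 0 < ellhat ell x.
Proof.
have h : 2^-1 < 1 :> R by lra.
have n1 : \forall n \near \oo, 2^-1 <= a n ^+ 2 / (n%:R * ellhat ell (a n)).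
  exact: cvgr_ge norming _ h.
have n2 : \forall n \near \oo, X <= a n by exact: near_a_ge.
have [n _ /(_ n (leqnn n))[h1 h2]] : \forall n \near \oo,
    2^-1 <= a n ^+ 2 / (n%:R * ellhat ell (a n)) /\ X <= a n.
  by near=> n; split; near: n.
exists (a n) => //; rewrite ltNge; apply/negP => H0.
have : a n ^+ 2 / (n%:R * ellhat ell (a n)) <= 0.
  by rewrite mulr_ge0_le0 ?sqr_ge0// invr_le0 mulr_ge0_le0.
by lra.
Unshelve. all: by end_near. Qed.

(** The level [N / 2] leaves room for the non-strict events such as [S_n <= - N]. *)
Lemma boundary_bounds : exists A : R, [/\ 0 <= A,
  (\forall n \near \oo, n%:R * t (N n / 2) <= A * (n%:R * Phi (N n))) &
  \forall n \near \oo, Pr (absgt T v n (N n / 2)) <= A * (n%:R * Phi (N n))].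
Proof.
have tail2 : t x / regvar ell 2 x @[x --> +oo] --> (1 : R).
  by rewrite -alpha2; exact: tail_abs.
have t_ge0 x : 0 <= t x by exact: Pr_ge0.
have [X0 X01 H] := ellhat_comparator sv ell_int t_ge0 t_mono tail2
  ellhat_frequently_gt0.
have X00 : 0 < X0 by exact: lt_le_trans X01.
have B1 : 1 <= 25 :> R by rewrite ler1n.
have rho01 : 0 < (5^-1 : R) < 1 by apply/andP; split; lra.
have Phi0 x : X0 <= x -> 0 < Phi x by move=> /H[].
have Phiv x : X0 <= x -> t x <= 1 * Phi x by rewrite mul1r => /H[].
have Phiup (x y : R) : X0 <= x -> x <= y -> y <= 5 * x -> Phi y <= 25 * Phi x.
  by move=> /H[_ _ h _ _]; exact: h.
have Phidn (x y : R) : X0 <= x -> x <= y -> y <= 5 * x -> Phi x <= 25 * Phi y.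
  by move=> /H[_ _ _ h _]; exact: h.
have Phidec (x : R) : X0 <= x -> Phi (5 * x) <= 5^-1 * Phi x by move=> /H[].
have Phia : n%:R * Phi (a n) @[n --> \oo] --> (1 : R).
  rewrite -[X in _ --> X]invr1.
  apply: cvg_trans (cvgV (oner_neq0 R) norming).
  by apply: near_eq_cvg; near=> n => /=; rewrite invf_div mulrA.
have h0 : 0 < 2^-1 :> R by lra.
have h1 : 2^-1 <= 1 :> R by lra.
have [A A0 HA] := large_deviation_scaled GM mv v_lip X00 ler01 B1 rho01 Phi0 Phiv
  Phiup Phidn Phidec a_gt0 a_infty Phia tight N_far h0 h1.
have NX : \forall n \near \oo, 2 * X0 <= N n.
  exact: (N_infty (nbhs_pinfty_ge (num_real (2 * X0)))).
exists (A + 25); split; first by rewrite addr_ge0.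
  near=> n; have Nn : 2 * X0 <= N n by near: n.
  have N2X : X0 <= N n / 2 by lra.
  have P0 : 0 < Phi (N n) by apply: Phi0; lra.
  apply: (@le_trans _ _ (25 * (n%:R * Phi (N n)))).
    rewrite [leRHS]mulrCA ler_wpM2l//.
    have := Phiv _ N2X; rewrite mul1r => /le_trans; apply.
    by apply: Phidn => //; lra.
  by rewrite ler_wpM2r ?lerDr// mulr_ge0// ltW.
near=> n; have Nn : 2 * X0 <= N n by near: n.
have P0 : 0 < Phi (N n) by apply: Phi0; lra.
have HAn : forall m, (m <= n)%N ->
    Pr (absgt T v m (2^-1 * N n)) <= A * (n%:R * Phi (N n)) by near: n.
rewrite [N n / 2]mulrC; apply: le_trans (HAn n (leqnn n)) _.
by rewrite ler_wpM2r ?lerDl// mulr_ge0// ltW.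
Unshelve. all: by end_near. Qed.

Lemma large_deviation_boundary : exists2 C : R, 0 <= C &
  (\forall n \near \oo,
    `|Pr [set y | N n < S n y] - n%:R * Pr [set y | N n < v y]|
      <= C * (n%:R * Phi (N n))) /\
  (\forall n \near \oo,
    `|Pr [set y | S n y <= - N n] - n%:R * Pr [set y | v y <= - N n]|
      <= C * (n%:R * Phi (N n))).
Proof.
have [A [A0 HA1 HA2]] := boundary_bounds.
have NX : \forall n \near \oo, 1 <= N n.
  exact: (N_infty (nbhs_pinfty_ge (num_real 1))).
have dist (x y B : R) : 0 <= x -> 0 <= y -> x <= B -> y <= B -> `|x - y| <= B.
  by move=> *; rewrite ler_norml; apply/andP; split; lra.
have mle (f : Omega -> R) x : measurable_fun setT f -> measurable [set y | f y <= x].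
  move=> mf; have := mf measurableT `]-oo, x]%classic (measurable_itv _).
  by rewrite setTI preimage_itvNyc.
have mS n := measurable_birkhoff GM mv n.
exists A => //; split; near=> n; have N1 : 1 <= N n by near: n.
all: have h1 : n%:R * t (N n / 2) <= A * (n%:R * Phi (N n)) by near: n.
all: have h2 : Pr (absgt T v n (N n / 2)) <= A * (n%:R * Phi (N n)) by near: n.
- apply: dist; rewrite ?mulr_ge0 ?Pr_ge0//.
  + apply: le_trans h2; apply: le_Pr; first exact: measurable_gt.
      exact: (measurable_absgt GM mv).
    by move=> y /= h; apply: lt_le_trans (ler_norm _); lra.
  + apply: le_trans h1; rewrite ler_wpM2l//; apply: le_Pr => //.
    by move=> y /= h; apply: lt_le_trans (ler_norm _); lra.
- apply: dist; rewrite ?mulr_ge0 ?Pr_ge0//.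
  + apply: le_trans h2; apply: le_Pr; first exact: mle.
      exact: (measurable_absgt GM mv).
    by move=> y /= h; rewrite /absgt/= -normrN; apply: lt_le_trans (ler_norm _); lra.
  + apply: le_trans h1; rewrite ler_wpM2l//; apply: le_Pr => //; first exact: mle.
    by move=> y /= h; rewrite -normrN; apply: lt_le_trans (ler_norm _); lra.
Unshelve. all: by end_near. Qed.

End BoundaryCase.
End LargeDeviations.


(** * From the hypotheses of the theorem to the two norming regimes *)

Theorem theorem1p3 (R : realType) (d : measure_display) (Omega : measurableType d)
  (mu : probability Omega R) (T : Omega -> Omega) (J : countType)
  (P : J -> set Omega) (theta : R)
  (v : Omega -> R) (alpha p q : R) (ell : R -> R)
  (a b : nat -> R) (N : nat -> R) :
  GibbsMarkov mu T P theta -> mixing mu T ->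
  measurable_fun setT v ->
  (\int[mu]_x ((v x) ^+ 2)%:E = +oo)%E ->
  ((0 < alpha < 1) \/ (1 < alpha <= 2)) ->
  slowly_varying ell -> 0 < p -> 0 < q -> p + q = 1 ->
  fine (mu [set y | x < v y]) / (p * ell x * x `^ (- alpha))
     @[x --> +oo] --> (1 : R) ->
  fine (mu [set y | v y < - x]) / (q * ell x * x `^ (- alpha))
     @[x --> +oo] --> (1 : R) ->
  (* alpha = 2: ell u / u integrable on [1, x], so that \hat ell is defined *)
  (alpha = 2 -> forall x : R, 1 <= x ->
     (@lebesgue_measure R).-integrable `[1, x]%classic (fun u => (ell u / u)%:E)) ->
  (* |v|_theta = sup_j D_j v < oo *)
  (exists K : R, forall j, Dj_le P T theta v j K) ->
  (* D_j v <= C inf_{Omega_j} |v| *)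
  (exists C : R, 0 < C /\ forall j z, P j z -> Dj_le P T theta v j (C * `|v z|)) ->
  (1 < alpha -> (\int[mu]_x (v x)%:E = 0)%E) ->
  (* a_n: a_n^alpha = n ell(a_n)(1+o(1)) (alpha<2), a_n^2 = n hat ell(a_n)(1+o(1)) *)
  (forall n, 0 < a n) -> a n @[n --> \oo] --> +oo ->
  (alpha < 2 -> a n `^ alpha / (n%:R * ell (a n)) @[n --> \oo] --> (1 : R)) ->
  (alpha = 2 -> a n ^+ 2 / (n%:R * ellhat ell (a n)) @[n --> \oo] --> (1 : R)) ->
  (* b_n *)
  (forall n, b n = if alpha < 1 then 0 else n%:R * fine (\int[mu]_x (v x)%:E)%E) ->
  (exists G : probability R R, stable_law alpha G /\
     conv_in_distribution mu (fun n y => (birkhoff T v n y - b n) / a n) G) ->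
  N n @[n --> \oo] --> +oo ->
  N n / a n @[n --> \oo] --> +oo ->
  forall delta : R, 0 < delta ->
  let D := fun x : R => if alpha < 1 then ln x * ell x * x `^ (- alpha)
                        else x `^ (- (alpha - delta)) in
  (alpha < 2 ->
    (exists C : R, forall eps : R, 0 < eps -> \forall n \near \oo,
      `|fine (mu [set y | N n < birkhoff T v n y]) - n%:R * fine (mu [set y | N n < v y])|
        <= C * D (N n) + eps * (n%:R * ell (N n) * N n `^ (- alpha))) /\
    (exists C : R, forall eps : R, 0 < eps -> \forall n \near \oo,
      `|fine (mu [set y | birkhoff T v n y < - N n]) - n%:R * fine (mu [set y | v y < - N n])|
        <= C * D (N n) + eps * (n%:R * ell (N n) * N n `^ (- alpha)))) /\
  (alpha = 2 ->
    (exists C : R, \forall n \near \oo,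
      `|fine (mu [set y | N n < birkhoff T v n y]) - n%:R * fine (mu [set y | N n < v y])|
        <= C * (D (N n) + n%:R * ln (N n) * N n `^ (-2)
                + n%:R * ellhat ell (N n) * N n `^ (-2))) /\
    (exists C : R, \forall n \near \oo,
      `|fine (mu [set y | birkhoff T v n y <= - N n]) - n%:R * fine (mu [set y | v y <= - N n])|
        <= C * (D (N n) + n%:R * ln (N n) * N n `^ (-2)
                + n%:R * ellhat ell (N n) * N n `^ (-2)))).
Proof.
move=> GM _ mv _ alphaP sv p0 q0 pq1 tail_p tail_q ell_int v_lip _ mean0.
move=> a0 a_infty norm_lt2 norm_2 bE [G [_ convG]] N_infty N_far delta delta0 D.
have alpha0 : 0 < alpha by case: alphaP => /andP[h _]; lra.
(* The centering vanishes by definition below 1 and by the zero mean above 1, so the limit law gives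
   tightness of [S_n / a_n] itself. *)
have b0 n : b n = 0.
  rewrite bE; case: alphaP => /andP[h1 h2]; first by rewrite h2.
  by rewrite ltNge (ltW h1)/= mean0// mulr0.
have tight (eta : R) : 0 < eta ->
    exists M : R, \forall n \near \oo, Pr mu (absgt T v n (M * a n)) <= eta.
  move=> eta0.
  have mX n : measurable_fun setT (fun y => (birkhoff T v n y - b n) / a n).
    apply: measurable_funM => //; apply: measurable_funB => //.
    exact: (measurable_birkhoff GM).
  have [M HM] := conv_in_distribution_tight mX convG eta0.
  exists M; apply: filterS HM => n; congr (Pr mu _ <= _).
  apply/seteqP; split => y; rewrite /absgt/= b0 subr0 normrM normfV;
  by rewrite (gtr0_norm (a0 n)) ltr_pdivlMr.
split => [alpha2|alpha2].
(* The single-jump estimate is [o(n ell(N) N^-alpha)] on its own, so the constant before [D] can be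
   0. *)
- split; exists 0 => eps eps0.
    have := large_deviation_stable_up GM mv v_lip alpha0 sv p0 q0 pq1 tail_p tail_q
      a0 a_infty tight N_infty N_far (norm_lt2 alpha2) eps0.
    by apply: filterS => n; rewrite mul0r add0r -mulrA.
  have := large_deviation_stable_down GM mv v_lip alpha0 sv p0 q0 pq1 tail_p tail_q
    a0 a_infty tight N_infty N_far (norm_lt2 alpha2) eps0.
  by apply: filterS => n; rewrite mul0r add0r -mulrA.
have [C C0 [HC1 HC2]] := large_deviation_boundary GM mv v_lip sv p0 q0 pq1 tail_p
  tail_q a0 a_infty tight N_infty N_far alpha2 (ell_int alpha2) (norm_2 alpha2).
have N1 : \forall n \near \oo, 1 <= N n.
  by move/cvgryPge : (N_infty) => /(_ 1).
(* The other two summands of the target are nonnegative once [N n >= 1], so they can be added. *)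
have bound n (x : R) : 1 <= N n -> x <= C * (n%:R * (ellhat ell (N n) / N n ^+ 2)) ->
  x <= C * (D (N n) + n%:R * ln (N n) * N n `^ (-2)
    + n%:R * ellhat ell (N n) * N n `^ (-2)).
  move=> Nn1 /le_trans; apply; rewrite ler_wpM2l//.
  have N0 : 0 <= N n by exact: le_trans Nn1.
  rewrite mulrA [in leRHS]powR_invn// lerDr addr_ge0//.
    by rewrite /D alpha2 ltNge ler1n/= powR_ge0.
  by rewrite !mulr_ge0 ?ln_ge0 ?invr_ge0 ?exprn_ge0.
split; exists C; near=> n; apply: bound; near: n => //.
Unshelve. all: by end_near. Qed.
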